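(* Let $R>1$. The initial value problem $$\frac{dy}{dx} = \frac{\arccos\left(\frac{x}{Ry}\right) - \mathrm{Ac}\left(\frac{x}{y}\right)}{R\,\sqrt{1 - \left(\frac{x}{Ry}\right)^2} - \mathrm{Sr}\left(1-\left(\frac{x}{y}\right)^2\right)},\qquad y(0) = \frac{\pi}{R-1},$$ has a unique solution $y=\alpha(x)$ for $x\ge 0$, and this solution satisfies $$\lim_{k\to\infty}\frac{a_{kx,k}}{k}=\alpha(x)\qquad\text{for every } x\geq 0,$$ where the limit is over positive integers $k$ and $a_{kx,k}$ is the $k$-th positive zero of the cross-product $f_{\nu,R}$ of order $\nu=kx$.
   Context: For $\nu\ge 0$ and $R>1$, let $f_{\nu,R}(z)=J_\nu(Rz)Y_\nu(z)-J_\nu(z)Y_\nu(Rz)$ for $z>0$, where $J_\nu$ and $Y_\nu$ are the Bessel functions of the first and second kind of order $\nu$. It is well known that $f_{\nu,R}$ has infinitely many positive zeros, all simple; $a_{\nu,k}$ denotes the $k$-th positive zero in increasing order, $k=1,2,\dots$ ($R$ is suppressed in the notation). The functions $\mathrm{Ac}$ and $\mathrm{Sr}$ are the zero extensions of $\arccos$ and the square root: $\mathrm{Ac}(t)=\arccos t$ for $|t|\le 1$ and $\mathrm{Ac}(t)=0$ for $|t|>1$; $\mathrm{Sr}(t)=\sqrt{t}$ for $t\ge 0$ and $\mathrm{Sr}(t)=0$ for $t<0$. The differential equation is considered in the region $\{(x,y): x\ge 0,\ y>x/R\}$, on which its right-hand side is defined; a solution on $[0,\infty)$ is a differentiable function whose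 graph lies in this region and which satisfies the equation and the initial condition. *)

(* Defs.v *)
From Stdlib Require Import Reals Factorial ClassicalEpsilon.
From Coquelicot Require Import Coquelicot.
Open Scope R_scope.

(** The reciprocal Gamma function [1 / Gamma x], by Gauss's limit formula
    [1 / Gamma x = lim_n x (x + 1) ... (x + n) / (n! n ^ x)].  It holds for every
    real [x], including the poles of Gamma, where both sides vanish. *)
Definition rgamma (x : R) : R :=
  real (Lim_seq (fun n : nat =>
    prod_f_R0 (fun i => x + INR i) n / (INR (fact n) * Rpower (INR n) x))).

(** [J_nu z = (z/2)^nu sum_m (-1)^m / (m! Gamma (m + nu + 1)) (z/2)^(2m)] for
    [z > 0] and every real order [nu]; negative orders occur in [bessel_Y]. *)
Definition bessel_J (nu z : R) : R :=
  Rpower (z / 2) nu *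
  PSeries (fun m : nat => (-1) ^ m / INR (fact m) * rgamma (INR m + nu + 1))
    ((z / 2) ^ 2).

Definition bessel_Y_quotient (nu z : R) : R :=
  (bessel_J nu z * cos (nu * PI) - bessel_J (- nu) z) / sin (nu * PI).

(** [sin (nu * PI) = 0] means that [nu] is an integer; there [Y_nu z] is the
    limit of the quotient as the order tends to [nu]. *)
Definition bessel_Y (nu z : R) : R :=
  if Req_EM_T (sin (nu * PI)) 0
  then real (Lim (fun mu => bessel_Y_quotient mu z) nu)
  else bessel_Y_quotient nu z.

(** The real number [R > 1] of the text is written [rho], [R] being the type of
    real numbers. *)
Definition bessel_cross (nu rho z : R) : R :=
  bessel_J nu (rho * z) * bessel_Y nu z - bessel_J nu z * bessel_Y nu (rho * z).

(** [a 1 < a 2 < ...] are exactly the positive zeros of [f]; [a 0] is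
    unconstrained. *)
Definition enumerates_positive_zeros (f : R -> R) (a : nat -> R) : Prop :=
  (forall k : nat, (1 <= k)%nat -> a k < a (S k)) /\
  (forall z : R, (0 < z /\ f z = 0) <-> exists k : nat, (1 <= k)%nat /\ z = a k).

(** The enumeration is determined at every [k >= 1], so [epsilon] acts here as a
    definite description.  Nothing is known about the chosen sequence unless the
    zeros are shown to admit such an enumeration. *)
Definition cross_zero (rho nu : R) (k : nat) : R :=
  epsilon (inhabits (fun _ : nat => 0))
    (enumerates_positive_zeros (bessel_cross nu rho)) k.

Definition Ac (t : R) : R := if Rle_dec (Rabs t) 1 then acos t else 0.

Definition Sr (t : R) : R := if Rle_dec 0 t then sqrt t else 0.

Definition ode_rhs (rho x y : R) : R :=
  (acos (x / (rho * y)) - Ac (x / y)) /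
  (rho * sqrt (1 - (x / (rho * y)) ^ 2) - Sr (1 - (x / y) ^ 2)).

(** [D_in] is the derivative relative to a domain: two-sided at [x > 0] and
    one-sided at [x = 0].  Only the values of [y] on [[0, +oo)] matter. *)
Definition ivp_solution (rho : R) (y : R -> R) : Prop :=
  y 0 = PI / (rho - 1) /\
  (forall x : R, 0 <= x -> x / rho < y x) /\
  (forall x : R, 0 <= x ->
     D_in y (fun t => ode_rhs rho t (y t)) (fun t => 0 <= t) x).

(* Main.v *)
Require Import Defs.
From Stdlib Require Import Reals Lra Lia ZArith Classical ClassicalEpsilon.
From Stdlib Require Import Ranalysis5.
From Coquelicot Require Import Coquelicot.
Open Scope R_scope.

(** Put [z = 2 e^s].  Bessel's equation becomes [w'' = - Q w] with the increasing
    potential [Q s = 4 e^(2s) - nu^2 = z^2 - nu^2], and the cross-product at [z] is, up to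
    sign, the determinant of two independent solutions at the points [s] and
    [s + ln rho].  In polar coordinates [(M, th)] of that pair it is a nonzero multiple
    of [sin (th (s + ln rho) - th s)].  So the zeros are the points where the phase
    [th] gains a multiple of [PI] over a window of length [ln rho].

    Everything about the zeros then follows from Sturm's comparison theorem in the form
    [sturm]: a larger potential gains more phase, counted in half-turns.  Comparing the
    equation with its own translates, a gain once reached is exceeded further right
    ([window_gain_increasing]); as the gain is small near [z = 0] and unbounded, each
    value [k PI] is taken exactly once, at the [k]-th zero ([phase_enumeration]).
    Comparing with constant potentials, the phase grows on an interval by the frequency
    times the length, up to one half-turn ([phase_upper], [phase_lower]).

    For [nu = k x] and [z = k y] this is applied on the cells of a partition of the
    window.  With [t = 2 e^s / k] the potential is [k^2 (t^2 - x^2)], so the gain is [k]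
    times a Riemann sum of [sqrt (t^2 - x^2) dt / t], up to one half-turn per cell.
    Dividing by [k] and refining the partition afterwards, the gain over [k] tends to
    [y * action rho (x / y)], the integral of [sqrt (max (t^2 - x^2, 0)) / t] from [y] to
    [rho y] ([phase_asymptotics_eps]).  This function is increasing in [y > x / rho], and
    the quotient of the [k]-th zero by [k] therefore tends to the [y] at which it equals
    [PI].

    The differential equation says exactly that [y * action rho (x / y)] is constant
    along a solution, and the initial value makes the constant [PI]: this gives
    uniqueness ([ivp_solution_level]).  The level curve is parametrised by [r = x / y],
    which gives existence through a one-variable inverse function.

    There remains that [J_nu] and [Y_nu] are independent solutions.  The coefficients of
    [J_nu] satisfy a two-term recurrence because [1 / Gamma] satisfies the functional
    equation of Gamma; at an integer order, [Y_n] is found by differentiating the series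
    of [J_nu] term by term in the order, which needs the derivative of [1 / Gamma] at the
    integers.  The Wronskian is a constant, and is computed as [z] tends to [0]
    ([bessel_pair]). *)

(** * Calculus on the line *)

Lemma MVT_derive (f df : R -> R) (a b : R) :
  a < b -> (forall x, a <= x <= b -> is_derive f x (df x)) ->
  exists c, a <= c <= b /\ f b - f a = df c * (b - a).
Proof.
  intros Hab Hd.
  destruct (MVT_gen f a b df) as [c [Hc E]].
  - rewrite Rmin_left, Rmax_right by lra. intros x Hx. apply Hd; lra.
  - rewrite Rmin_left, Rmax_right by lra. intros x Hx.
    apply derivable_continuous_pt. exists (df x). apply is_derive_Reals, Hd; lra.
  - rewrite Rmin_left, Rmax_right in Hc by lra. exists c. split; [lra|exact E].
Qed.

Lemma MVT_derive_open (f df : R -> R) (a b : R) :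
  a < b -> (forall x, a < x < b -> is_derive f x (df x)) ->
  (forall x, a <= x <= b -> continuity_pt f x) ->
  exists c, a < c < b /\ f b - f a = df c * (b - a).
Proof.
  intros Hab Hd Hc.
  assert (pr : forall c, a < c < b -> derivable_pt f c).
  { intros c H. exists (df c). apply is_derive_Reals, Hd, H. }
  destruct (MVT f id a b pr (fun c _ => derivable_pt_id c) Hab Hc) as [c [P E]].
  { intros. apply derivable_continuous, derivable_id. }
  exists c. split; [exact P|].
  rewrite derive_pt_id in E. unfold id in E.
  assert (D : derive_pt f c (pr c P) = df c).
  { apply derive_pt_eq_0, is_derive_Reals, Hd, P. }
  rewrite D in E. lra.
Qed.

Lemma derive_pos_increasing (f df : R -> R) (a b : R) :
  a < b -> (forall x, a < x < b -> is_derive f x (df x)) ->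
  (forall x, a <= x <= b -> continuity_pt f x) ->
  (forall x, a < x < b -> 0 < df x) -> f a < f b.
Proof.
  intros Hab Hd Hc Hp.
  destruct (MVT_derive_open f df a b Hab Hd Hc) as [c [P E]].
  assert (0 < df c * (b - a)) by (apply Rmult_lt_0_compat; [apply Hp, P|lra]). lra.
Qed.

Lemma derive_zero_const (f : R -> R) :
  (forall x, is_derive f x 0) -> forall a b, f a = f b.
Proof.
  intros Hd.
  assert (H : forall a b, a < b -> f a = f b).
  { intros a b Hab. destruct (MVT_derive f (fun _ => 0) a b Hab) as [c [_ E]];
      [intros; apply Hd|lra]. }
  intros a b. destruct (Rtotal_order a b) as [L|[L|L]];
    [apply H, L|now rewrite L|symmetry; apply H, L].
Qed.

Lemma is_derive_continuity_pt (f : R -> R) (x l : R) :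
  is_derive f x l -> continuity_pt f x.
Proof.
  intros H. apply derivable_continuous_pt. exists l. now apply is_derive_Reals.
Qed.

(** The conclusion is only a weak inequality, but it spares the Sturm argument
    below any appeal to the uniqueness of solutions: it need not know that the slope of
    a solution at a zero is different from [0]. *)
Lemma derive_nonpos_at_right_end (f : R -> R) (a b l : R) :
  a < b -> (forall x, a < x < b -> 0 < f x) -> f b = 0 -> is_derive f b l -> l <= 0.
Proof.
  intros Hab Hp Hz Hd. apply Rnot_lt_le. intros Hl.
  apply is_derive_Reals in Hd.
  destruct (Hd l Hl) as [d Hd'].
  set (h := Rmin (d / 2) ((b - a) / 2)).
  assert (0 < d) by apply cond_pos.
  assert (h <= d / 2) by apply Rmin_l.
  assert (h <= (b - a) / 2) by apply Rmin_r.
  assert (0 < h) by (apply Rmin_glb_lt; lra).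
  specialize (Hd' (- h) ltac:(lra)).
  rewrite Rabs_Ropp, Rabs_pos_eq in Hd' by lra.
  specialize (Hd' ltac:(lra)).
  rewrite Hz in Hd'.
  assert (0 < f (b + - h)) by (apply Hp; lra).
  assert (0 < f (b + - h) / h) by (apply Rdiv_lt_0_compat; lra).
  replace ((f (b + - h) - 0) / - h) with (- (f (b + - h) / h)) in Hd' by (field; lra).
  rewrite Rabs_left in Hd'; lra.
Qed.

(** * Phases of Sturm-Liouville equations *)

(** The equation [w'' = - Q w].  The derivative is carried along as a function, so that
    Wronskians are plain expressions. *)
Definition solves (Q w dw : R -> R) : Prop :=
  (forall s, is_derive w s (dw s)) /\ (forall s, is_derive dw s (- Q s * w s)).

(** Polar coordinates [(M, th)] of a pair of independent solutions: all solutions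
    of [w'' = - Q w] are then multiples of the functions [M sin (th - c)], so a
    solution that vanishes at [a] vanishes again exactly when [th] has grown by a
    multiple of [PI]. *)
Definition phase (Q th M : R -> R) : Prop :=
  (forall s, 0 < M s) /\
  continuity th /\
  (forall s t, s < t -> th s < th t) /\
  (forall c, exists dw, solves Q (fun s => M s * sin (th s - c)) dw).

Lemma phase_const (c : R) : 0 < c -> phase (fun _ => c ^ 2) (fun s => c * s) (fun _ => 1).
Proof.
  intros Hc. repeat split.
  - intros; lra.
  - intros s. apply (is_derive_continuity_pt _ s c). auto_derive; [easy|ring].
  - intros s t H. now apply Rmult_lt_compat_l.
  - intros d. exists (fun s => c * cos (c * s - d)). split; intros s.
    + auto_derive; [easy|unfold Rminus; ring].
    + auto_derive; [easy|unfold Rminus; ring].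
Qed.

Lemma phase_shift (Q th M : R -> R) (h : R) :
  phase Q th M -> phase (fun s => Q (s + h)) (fun s => th (s + h)) (fun s => M (s + h)).
Proof.
  intros [HM [Hc [Hi Hs]]].
  assert (Sh : forall f : R -> R, forall s l,
            is_derive f (s + h) l -> is_derive (fun s => f (s + h)) s l).
  { intros f s l H. apply (is_derive_ext (fun s => f (s + h))); [easy|].
    replace l with (scal 1 l) by apply Rmult_1_l.
    apply (is_derive_comp f (fun s => s + h) s l 1); [exact H|].
    auto_derive; [easy|ring]. }
  repeat split.
  - intros; apply HM.
  - intros s. apply (continuity_pt_comp (fun s => s + h) th); [|apply Hc].
    apply (is_derive_continuity_pt _ s 1). auto_derive; [easy|ring].
  - intros s t H. apply Hi. lra.
  - intros c. destruct (Hs c) as [dw [H1 H2]]. exists (fun s => dw (s + h)).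
    split; intros s.
    + apply (Sh (fun s => M s * sin (th s - c))), H1.
    + apply (Sh dw), H2.
Qed.

(** Sturm's comparison between consecutive zeros: while [w1] runs from a zero at
    [a] to its next zero [b], the Wronskian [w1' w2 - w1 w2'] grows from [0], as
    [w1 w2 > 0] and [Q1 < Q2]; but at [b] it is [w1' w2 <= 0] unless [w2] has
    already vanished. *)
Lemma sturm_step (Q1 th1 M1 Q2 th2 M2 : R -> R) (a b : R) :
  phase Q1 th1 M1 -> phase Q2 th2 M2 -> a < b ->
  (forall s, a < s < b -> Q1 s < Q2 s) ->
  th1 b - th1 a = PI -> PI < th2 b - th2 a.
Proof.
  intros [P1 [_ [I1 S1]]] [P2 [_ [I2 S2]]] Hab HQ E.
  apply Rnot_le_lt. intros Hle.
  destruct (S1 (th1 a)) as [d1 [D1 D1']]. destruct (S2 (th2 a)) as [d2 [D2 D2']].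
  set (w1 := fun s => M1 s * sin (th1 s - th1 a)) in *.
  set (w2 := fun s => M2 s * sin (th2 s - th2 a)) in *.
  assert (W1 : forall s, a < s < b -> 0 < w1 s).
  { intros s Hs. apply Rmult_lt_0_compat; [apply P1|].
    pose proof (I1 a s (proj1 Hs)). pose proof (I1 s b (proj2 Hs)).
    apply sin_gt_0; lra. }
  assert (W2 : forall s, a < s < b -> 0 < w2 s).
  { intros s Hs. apply Rmult_lt_0_compat; [apply P2|].
    pose proof (I2 a s (proj1 Hs)). pose proof (I2 s b (proj2 Hs)).
    apply sin_gt_0; lra. }
  assert (W1a : w1 a = 0) by (unfold w1; rewrite Rminus_diag, sin_0; ring).
  assert (W2a : w2 a = 0) by (unfold w2; rewrite Rminus_diag, sin_0; ring).
  assert (W1b : w1 b = 0) by (unfold w1; rewrite E, sin_PI; ring).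
  assert (W2b : 0 <= w2 b).
  { apply Rmult_le_pos; [left; apply P2|]. pose proof (I2 a b Hab).
    apply sin_ge_0; lra. }
  assert (N : d1 b <= 0) by (apply (derive_nonpos_at_right_end w1 a b); auto).
  set (wr := fun s => d1 s * w2 s - w1 s * d2 s).
  assert (Dwr : forall s, is_derive wr s ((Q2 s - Q1 s) * (w1 s * w2 s))).
  { intros s. unfold wr.
    replace ((Q2 s - Q1 s) * (w1 s * w2 s))
      with (((- Q1 s * w1 s) * w2 s + d1 s * d2 s) - (d1 s * d2 s + w1 s * (- Q2 s * w2 s)))
      by ring.
    apply (is_derive_minus (fun s => d1 s * w2 s) (fun s => w1 s * d2 s)).
    - apply (is_derive_mult d1 w2); auto. intros; apply Rmult_comm.
    - apply (is_derive_mult w1 d2); auto. intros; apply Rmult_comm. }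
  assert (wr a < wr b).
  { apply (derive_pos_increasing wr (fun s => (Q2 s - Q1 s) * (w1 s * w2 s))); auto.
    - intros s _. eapply is_derive_continuity_pt, Dwr.
    - intros s Hs. apply Rmult_lt_0_compat; [|apply Rmult_lt_0_compat; auto].
      specialize (HQ s Hs). lra. }
  unfold wr in H. rewrite W1a, W2a, W1b in H.
  assert (d1 b * w2 b <= 0).
  { rewrite <- (Rmult_0_l (w2 b)). now apply Rmult_le_compat_r. }
  lra.
Qed.

Lemma sturm (m : nat) (Q1 th1 M1 Q2 th2 M2 : R -> R) (a b : R) :
  phase Q1 th1 M1 -> phase Q2 th2 M2 -> a < b ->
  (forall s, a < s < b -> Q1 s < Q2 s) -> (1 <= m)%nat ->
  INR m * PI <= th1 b - th1 a -> INR m * PI < th2 b - th2 a.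
Proof.
  intros H1 H2. revert a. induction m as [|m IH]; [lia|].
  intros a Hab HQ _ Hm.
  pose proof PI_RGT_0 as Hpi.
  assert (0 <= INR m) by apply pos_INR.
  rewrite S_INR in Hm |- *.
  assert (0 <= INR m * PI) by (apply Rmult_le_pos; lra).
  destruct H1 as [P1 [C1 [I1 S1]]]. destruct H2 as [P2 [C2 [I2 S2]]].
  destruct (IVT_gen th1 a b (th1 a + PI) C1) as [d [Hd E]].
  { rewrite Rmin_left, Rmax_right; lra. }
  rewrite Rmin_left, Rmax_right in Hd by lra.
  assert (Had : a < d) by (destruct (Req_dec a d) as [->|]; lra).
  assert (PI < th2 d - th2 a).
  { apply (sturm_step Q1 th1 M1 Q2 th2 M2); try (repeat split; assumption).
    - intros s Hs. apply HQ. lra.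
    - lra. }
  assert (th2 d <= th2 b).
  { destruct (Req_dec d b) as [->|]; [lra|]. left. apply I2. lra. }
  destruct m as [|m].
  { simpl. lra. }
  assert (0 < INR (S m) * PI) by (apply Rmult_lt_0_compat; [apply lt_0_INR; lia|lra]).
  assert (INR (S m) * PI < th2 b - th2 d); [|lra].
  apply IH.
  - destruct (Req_dec d b) as [->|]; lra.
  - intros s Hs. apply HQ. lra.
  - lia.
  - lra.
Qed.

Lemma floor_PI (D : R) : 0 <= D -> exists m : nat, INR m * PI <= D < (INR m + 1) * PI.
Proof.
  intros HD. pose proof PI_RGT_0 as Hpi.
  assert (0 <= D / PI) by (apply Rdiv_le_0_compat; lra).
  destruct (nfloor_ex (D / PI) H) as [m [A B]]. exists m. split.
  - apply (Rmult_le_compat_r PI) in A; [|lra]. unfold Rdiv in A.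
    rewrite Rmult_assoc, Rinv_l, Rmult_1_r in A by lra. exact A.
  - apply (Rmult_lt_compat_r PI) in B; [|lra]. unfold Rdiv in B.
    rewrite Rmult_assoc, Rinv_l, Rmult_1_r in B by lra. exact B.
Qed.

(** The comparison speed is [m PI / (b - a)], where [m] is the number of
    half-turns of [th]: it exceeds [c] strictly as soon as the bound fails. *)
Lemma phase_upper (Q th M : R -> R) (a b c : R) :
  phase Q th M -> a < b -> 0 <= c -> (forall s, a < s < b -> Q s <= c ^ 2) ->
  th b - th a <= c * (b - a) + PI.
Proof.
  intros H Hab Hc HQ. apply Rnot_lt_le. intros Hlt.
  pose proof PI_RGT_0 as Hpi.
  assert (0 <= c * (b - a)) by (apply Rmult_le_pos; lra).
  destruct (floor_PI (th b - th a)) as [m [A B]]; [lra|].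
  assert (Hm : (1 <= m)%nat) by (destruct m; [simpl in B; lra|lia]).
  set (c' := INR m * PI / (b - a)).
  assert (E : c' * (b - a) = INR m * PI) by (unfold c'; field; lra).
  assert (Hcc : c < c').
  { apply (Rmult_lt_reg_r (b - a)); lra. }
  assert (INR m * PI < c' * b - c' * a); [|lra].
  apply (sturm m Q th M (fun _ => c' ^ 2) (fun s => c' * s) (fun _ => 1)); auto.
  - apply phase_const. lra.
  - intros s Hs. specialize (HQ s Hs).
    assert (c ^ 2 < c' ^ 2); [|lra].
    simpl. rewrite !Rmult_1_r. apply Rmult_le_0_lt_compat; lra.
Qed.

Lemma phase_lower (Q th M : R -> R) (a b c : R) :
  phase Q th M -> a < b -> 0 <= c -> (forall s, a < s < b -> c ^ 2 <= Q s) ->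
  c * (b - a) - PI <= th b - th a.
Proof.
  intros H Hab Hc HQ. apply Rnot_lt_le. intros Hlt.
  pose proof PI_RGT_0 as Hpi.
  assert (th a < th b) by (apply H; auto).
  destruct (floor_PI (th b - th a)) as [m [A B]]; [lra|].
  set (c' := INR (S m) * PI / (b - a)).
  assert (E : c' * (b - a) = INR (S m) * PI) by (unfold c'; field; lra).
  rewrite <- S_INR in B.
  assert (0 < INR (S m) * PI) by (apply Rmult_lt_0_compat; [apply lt_0_INR; lia|lra]).
  assert (Hcc : c' < c).
  { apply (Rmult_lt_reg_r (b - a)); [lra|]. rewrite E, S_INR. lra. }
  assert (0 < c').
  { apply (Rmult_lt_reg_r (b - a)); lra. }
  assert (INR (S m) * PI < th b - th a); [|lra].
  apply (sturm (S m) (fun _ => c' ^ 2) (fun s => c' * s) (fun _ => 1) Q th M); auto.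
  - apply phase_const. lra.
  - intros s Hs. specialize (HQ s Hs).
    assert (c' ^ 2 < c ^ 2); [|lra].
    simpl. rewrite !Rmult_1_r. apply Rmult_le_0_lt_compat; lra.
  - lia.
  - lra.
Qed.

Lemma wronskian_const (Q u du v dv : R -> R) :
  solves Q u du -> solves Q v dv ->
  forall a b, u a * dv a - du a * v a = u b * dv b - du b * v b.
Proof.
  intros [U U'] [V V']. apply (derive_zero_const (fun s => u s * dv s - du s * v s)).
  intros s.
  replace 0 with ((du s * dv s + u s * (- Q s * v s)) - ((- Q s * u s) * v s + du s * dv s))
    by ring.
  apply (is_derive_minus (fun s => u s * dv s) (fun s => du s * v s)).
  - apply (is_derive_mult u dv); auto. intros; apply Rmult_comm.
  - apply (is_derive_mult du v); auto. intros; apply Rmult_comm.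
Qed.

(** The angle is [th = ∫ W / (u^2 + v^2)] with [W] the Wronskian.  In the frame
    rotating with it, the unit vector [(u, v) / M] stands still at some [(c1, c2)],
    and the sine of an angle difference is [u b v a - u a v b] up to the factor
    [- M a M b]. *)
Lemma phase_of_positive_pair (Q u du v dv : R -> R) :
  solves Q u du -> solves Q v dv -> (forall s, 0 < u s * dv s - du s * v s) ->
  exists th M, phase Q th M /\
    forall a b, u b * v a - u a * v b = 0 <-> sin (th b - th a) = 0.
Proof.
  intros [U U'] [V V'] HW.
  set (N := fun s => (u s) ^ 2 + (v s) ^ 2).
  assert (HN : forall s, 0 < N s).
  { intros s. specialize (HW s). unfold N.
    destruct (Req_dec (u s) 0) as [E|E].
    - destruct (Req_dec (v s) 0) as [E'|E'].
      + rewrite E, E' in HW. lra.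
      + assert (0 < (v s) ^ 2) by (apply pow2_gt_0, E'). pose proof (pow2_ge_0 (u s)). lra.
    - assert (0 < (u s) ^ 2) by (apply pow2_gt_0, E). pose proof (pow2_ge_0 (v s)). lra. }
  set (w := fun s => (u s * dv s - du s * v s) / N s).
  assert (Hw : forall s, 0 < w s) by (intros; now apply Rdiv_lt_0_compat).
  assert (Cw : forall s, continuous w s).
  { intros s. apply (ex_derive_continuous w). unfold w, N.
    auto_derive. repeat split; try (eexists; eauto; fail).
    specialize (HN s). unfold N in HN. simpl in HN. lra. }
  set (th := fun s => RInt w 0 s).
  assert (Dth : forall s, is_derive th s (w s)).
  { intros s. apply (is_derive_RInt w th 0 s); [|apply Cw].
    apply filter_forall. intros t. apply (RInt_correct w 0 t), (ex_RInt_continuous w).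
    intros; apply Cw. }
  set (M := fun s => sqrt (N s)).
  assert (HM : forall s, 0 < M s) by (intros; now apply sqrt_lt_R0).
  assert (MM : forall s, M s * M s = N s) by (intros; apply sqrt_sqrt; left; auto).
  assert (DM : forall s, is_derive M s ((u s * du s + v s * dv s) / M s)).
  { intros s. unfold M, N. auto_derive.
    - repeat split; try (eexists; eauto; fail). specialize (HN s).
      unfold N in HN. simpl in HN. lra.
    - rewrite (is_derive_unique (fun x : R => u x) _ _ (U s)), (is_derive_unique (fun x : R => v x) _ _ (V s)).
      replace (u s * (u s * 1) + v s * (v s * 1)) with (u s ^ 2 + v s ^ 2) by ring.
      fold (N s) (M s). specialize (HM s). unfold M, N in HM |- *. field. lra. }
  set (p := fun s => (u s * cos (th s) + v s * sin (th s)) / M s).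
  set (q := fun s => (v s * cos (th s) - u s * sin (th s)) / M s).
  assert (Dp : forall s, is_derive p s 0).
  { intros s. unfold p. auto_derive.
    - repeat split; try (eexists; eauto; fail). specialize (HM s). lra.
    - rewrite (is_derive_unique (fun x : R => u x) _ _ (U s)), (is_derive_unique (fun x : R => v x) _ _ (V s)),
        (is_derive_unique (fun x : R => M x) _ _ (DM s)), (is_derive_unique (fun x : R => th x) _ _ (Dth s)).
      unfold w. rewrite <- MM. specialize (HM s). specialize (MM s). unfold N in MM.
      apply (Rmult_eq_reg_r (M s * M s * M s)); [|repeat apply Rmult_integral_contrapositive_currified; lra].
      rewrite Rmult_0_l. field_simplify; [|lra].
      replace (M s ^ 2) with (u s ^ 2 + v s ^ 2) by (rewrite <- MM; ring). field; lra. }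
  assert (Dq : forall s, is_derive q s 0).
  { intros s. unfold q. auto_derive.
    - repeat split; try (eexists; eauto; fail). specialize (HM s). lra.
    - rewrite (is_derive_unique (fun x : R => u x) _ _ (U s)), (is_derive_unique (fun x : R => v x) _ _ (V s)),
        (is_derive_unique (fun x : R => M x) _ _ (DM s)), (is_derive_unique (fun x : R => th x) _ _ (Dth s)).
      unfold w. rewrite <- MM. specialize (HM s). specialize (MM s). unfold N in MM.
      apply (Rmult_eq_reg_r (M s * M s * M s)); [|repeat apply Rmult_integral_contrapositive_currified; lra].
      rewrite Rmult_0_l. field_simplify; [|lra].
      replace (M s ^ 2) with (u s ^ 2 + v s ^ 2) by (rewrite <- MM; ring). field; lra. }
  set (c1 := p 0). set (c2 := q 0).
  assert (Ep : forall s, u s * cos (th s) + v s * sin (th s) = c1 * M s).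
  { intros s. unfold c1. rewrite (derive_zero_const p Dp 0 s). unfold p. field.
    specialize (HM s); lra. }
  assert (Eq : forall s, v s * cos (th s) - u s * sin (th s) = c2 * M s).
  { intros s. unfold c2. rewrite (derive_zero_const q Dq 0 s). unfold q. field.
    specialize (HM s); lra. }
  assert (C : c1 ^ 2 + c2 ^ 2 = 1).
  { specialize (HM 0). specialize (Ep 0). specialize (Eq 0). specialize (MM 0).
    pose proof (sin2_cos2 (th 0)) as S. unfold Rsqr in S. unfold N in MM.
    apply (Rmult_eq_reg_r (M 0 * M 0)); [|apply Rgt_not_eq, Rmult_lt_0_compat; lra].
    replace ((c1 ^ 2 + c2 ^ 2) * (M 0 * M 0)) with ((c1 * M 0) ^ 2 + (c2 * M 0) ^ 2) by ring.
    rewrite <- Ep, <- Eq, MM.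
    transitivity ((u 0 ^ 2 + v 0 ^ 2) * (sin (th 0) * sin (th 0) + cos (th 0) * cos (th 0)));
      [ring|rewrite S; ring]. }
  assert (Ecos : forall s, M s * cos (th s) = c1 * u s + c2 * v s).
  { intros s. specialize (HM s).
    pose proof (sin2_cos2 (th s)) as S. unfold Rsqr in S. specialize (MM s). unfold N in MM.
    apply (Rmult_eq_reg_r (M s)); [|lra].
    replace ((c1 * u s + c2 * v s) * M s) with ((c1 * M s) * u s + (c2 * M s) * v s) by ring.
    rewrite <- Ep, <- Eq.
    replace (M s * cos (th s) * M s) with (M s * M s * cos (th s)) by ring.
    rewrite MM. ring. }
  assert (Esin : forall s, M s * sin (th s) = c1 * v s - c2 * u s).
  { intros s. specialize (HM s). specialize (MM s). unfold N in MM.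
    apply (Rmult_eq_reg_r (M s)); [|lra].
    replace ((c1 * v s - c2 * u s) * M s) with ((c1 * M s) * v s - (c2 * M s) * u s) by ring.
    rewrite <- Ep, <- Eq.
    replace (M s * sin (th s) * M s) with (M s * M s * sin (th s)) by ring.
    rewrite MM. ring. }
  exists th, M. split; [repeat split|].
  - exact HM.
  - intros s. apply (is_derive_continuity_pt _ _ _ (Dth s)).
  - intros s t Hst. apply (derive_pos_increasing th w s t); auto.
    intros x _. apply (is_derive_continuity_pt _ _ _ (Dth x)).
  - intros c.
    set (A := - c2 * cos c - c1 * sin c). set (B := c1 * cos c - c2 * sin c).
    assert (E : forall s, A * u s + B * v s = M s * sin (th s - c)).
    { intros s. rewrite sin_minus.
      replace (M s * (sin (th s) * cos c - cos (th s) * sin c))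
        with ((M s * sin (th s)) * cos c - (M s * cos (th s)) * sin c) by ring.
      rewrite Ecos, Esin. unfold A, B. ring. }
    exists (fun s => A * du s + B * dv s). split; intros s.
    + apply (is_derive_ext (fun s => A * u s + B * v s)); [exact E|].
      apply (is_derive_plus (fun s => A * u s) (fun s => B * v s));
        apply is_derive_scal; auto.
    + rewrite <- E.
      replace (- Q s * (A * u s + B * v s)) with (A * (- Q s * u s) + B * (- Q s * v s)) by ring.
      apply (is_derive_plus (fun s => A * du s) (fun s => B * dv s));
        apply is_derive_scal; auto.
  - intros a b.
    assert (E : u b * v a - u a * v b = - (M a * M b) * sin (th b - th a)).
    { rewrite sin_minus.
      replace (- (M a * M b) * (sin (th b) * cos (th a) - cos (th b) * sin (th a)))
        with ((M b * cos (th b)) * (M a * sin (th a)) - (M b * sin (th b)) * (M a * cos (th a)))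
        by ring.
      rewrite !Ecos, !Esin.
      transitivity ((c1 ^ 2 + c2 ^ 2) * (u b * v a - u a * v b)); [rewrite C; ring|ring]. }
    assert (0 < M a * M b) by (apply Rmult_lt_0_compat; auto).
    rewrite E. split; intros H0.
    + apply Rmult_integral in H0. destruct H0; [lra|easy].
    + rewrite H0. ring.
Qed.

Lemma phase_of_pair (Q u du v dv : R -> R) (s0 : R) :
  solves Q u du -> solves Q v dv -> u s0 * dv s0 - du s0 * v s0 <> 0 ->
  exists th M, phase Q th M /\
    forall a b, u b * v a - u a * v b = 0 <-> sin (th b - th a) = 0.
Proof.
  intros U V W. pose proof (wronskian_const Q u du v dv U V s0) as C.
  destruct (Rlt_dec 0 (u s0 * dv s0 - du s0 * v s0)) as [P|P].
  - apply (phase_of_positive_pair Q u du v dv); auto. intros s. rewrite <- C. exact P.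
  - (* exchange the two solutions to make the Wronskian positive *)
    destruct (phase_of_positive_pair Q v dv u du V U) as [th [M [H E]]].
    + intros s. specialize (C s). lra.
    + exists th, M. split; [exact H|]. intros a b. rewrite <- E. lra.
Qed.

(** * Counting zeros with the phase *)

(** With [z = 2 e^s], Bessel's equation of order [nu] becomes [w'' = - Q w] for this
    potential [Q = z^2 - nu^2]. *)
Definition bessel_potential (nu s : R) : R := 4 * exp s ^ 2 - nu ^ 2.

Lemma bessel_potential_increasing (nu s t : R) :
  s < t -> bessel_potential nu s < bessel_potential nu t.
Proof.
  intros H. unfold bessel_potential. apply exp_increasing in H. pose proof (exp_pos s).
  assert (exp s ^ 2 < exp t ^ 2); [|lra].
  simpl. rewrite !Rmult_1_r. apply Rmult_le_0_lt_compat; lra.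
Qed.

(** The zeros of the cross-product in the variable [s] are the points where the
    phase gains a multiple of [PI] over a window of fixed length [L].  Moving the
    window to the right increases the potential on it; so each multiple of [PI],
    once gained, is exceeded for ever. *)
Lemma window_gain_increasing (Q th M : R -> R) (L s t : R) (m : nat) :
  phase Q th M -> (forall s t, s < t -> Q s < Q t) -> 0 < L -> s < t -> (1 <= m)%nat ->
  INR m * PI <= th (s + L) - th s -> INR m * PI < th (t + L) - th t.
Proof.
  intros H HQ HL Hst Hm Hg.
  replace (t + L) with (s + L + (t - s)) by ring.
  replace (th t) with (th (s + (t - s))) by (f_equal; ring).
  apply (sturm m Q th M (fun x => Q (x + (t - s))) (fun x => th (x + (t - s)))
           (fun x => M (x + (t - s)))); auto.
  - now apply phase_shift.
  - lra.
  - intros x _. apply HQ. lra.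
Qed.

Lemma window_gain_small (nu : R) (th M : R -> R) (L : R) :
  phase (bessel_potential nu) th M -> 0 < L -> exists s, th (s + L) - th s < PI.
Proof.
  intros H HL. pose proof PI_RGT_0 as Hpi.
  set (c := PI / L).
  assert (Hc : 0 < c) by now apply Rdiv_lt_0_compat.
  set (s := ln (c / 2) - L). exists s.
  apply Rnot_le_lt. intros Hg.
  assert (E : exp (s + L) = c / 2).
  { unfold s. replace (ln (c / 2) - L + L) with (ln (c / 2)) by ring. apply exp_ln. lra. }
  assert (INR 1 * PI < c * (s + L) - c * s).
  { apply (sturm 1 (bessel_potential nu) th M (fun _ => c ^ 2) (fun x => c * x) (fun _ => 1)); auto.
    - now apply phase_const.
    - lra.
    - intros x Hx. apply Rlt_le_trans with (bessel_potential nu (s + L)).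
      + apply bessel_potential_increasing, Hx.
      + unfold bessel_potential. rewrite E. pose proof (pow2_ge_0 nu).
        replace (4 * (c / 2) ^ 2) with (c ^ 2) by field. lra.
    - simpl. lra. }
  replace (c * (s + L) - c * s) with PI in H0 by (unfold c; field; lra).
  simpl in H0. lra.
Qed.

Lemma window_gain_large (nu : R) (th M : R -> R) (L : R) (m : nat) :
  phase (bessel_potential nu) th M -> 0 < L -> exists s, INR m * PI <= th (s + L) - th s.
Proof.
  intros H HL. pose proof PI_RGT_0 as Hpi.
  set (c := (INR m * PI + PI) / L).
  assert (0 <= INR m * PI) by (apply Rmult_le_pos; [apply pos_INR|lra]).
  assert (Hc : 0 < c) by (apply Rdiv_lt_0_compat; lra).
  set (s := ln (c + Rabs nu)). exists s.
  pose proof (Rabs_pos nu) as Hn.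
  assert (c * (s + L - s) - PI <= th (s + L) - th s).
  { apply (phase_lower (bessel_potential nu) th M); auto; [lra|lra|].
    intros x Hx. left. apply Rle_lt_trans with (bessel_potential nu s).
    - unfold bessel_potential, s. rewrite exp_ln by lra.
      rewrite <- (pow2_abs nu).
      assert (0 <= c * Rabs nu) by (apply Rmult_le_pos; lra).
      assert (0 <= c * c) by (apply Rmult_le_pos; lra).
      assert (0 <= Rabs nu * Rabs nu) by (apply Rmult_le_pos; lra).
      simpl. lra.
    - apply bessel_potential_increasing, Hx. }
  replace (c * (s + L - s) - PI) with (INR m * PI) in H1 by (unfold c; field; lra).
  exact H1.
Qed.

Lemma window_gain_level (nu : R) (th M : R -> R) (L : R) (m : nat) :
  phase (bessel_potential nu) th M -> 0 < L -> (1 <= m)%nat ->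
  exists s, th (s + L) - th s = INR m * PI.
Proof.
  intros H HL Hm. pose proof PI_RGT_0 as Hpi.
  destruct (window_gain_small nu th M L H HL) as [a Ha].
  destruct (window_gain_large nu th M L m H HL) as [b Hb].
  assert (1 <= INR m) by (apply (le_INR 1), Hm).
  assert (PI <= INR m * PI).
  { rewrite <- (Rmult_1_l PI) at 1. apply Rmult_le_compat_r; lra. }
  destruct (IVT_gen (fun s => th (s + L) - th s) a b (INR m * PI)) as [s [_ Hs]].
  - intros s. apply continuity_pt_minus; [|apply H].
    apply (continuity_pt_comp (fun s => s + L) th); [|apply H].
    apply (is_derive_continuity_pt _ s 1). auto_derive; [easy|ring].
  - rewrite Rmin_left, Rmax_right; lra.
  - now exists s.
Qed.

Lemma sin_zero_nat (x : R) : 0 < x -> sin x = 0 -> exists k : nat, (1 <= k)%nat /\ x = INR k * PI.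
Proof.
  intros Hx Hs. destruct (sin_eq_0_0 x Hs) as [k E]. pose proof PI_RGT_0 as Hpi.
  assert (Hk : (0 < k)%Z).
  { apply lt_IZR. apply (Rmult_lt_reg_r PI); lra. }
  exists (Z.to_nat k). split; [lia|].
  rewrite INR_IZR_INZ, Z2Nat.id by lia. exact E.
Qed.

Lemma sin_nat_PI (k : nat) : sin (INR k * PI) = 0.
Proof.
  apply sin_eq_0_1. exists (Z.of_nat k). now rewrite INR_IZR_INZ.
Qed.

Lemma enumeration_unique (f : R -> R) (a b : nat -> R) :
  enumerates_positive_zeros f a -> enumerates_positive_zeros f b ->
  forall k, (1 <= k)%nat -> a k = b k.
Proof.
  assert (Mono : forall a : nat -> R, (forall k, (1 <= k)%nat -> a k < a (S k)) ->
            forall j k, (1 <= j)%nat -> (j < k)%nat -> a j < a k).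
  { intros c Hc j k Hj Hjk. induction Hjk as [|k Hjk IH]; [now apply Hc|].
    apply Rlt_trans with (c k); [exact IH|apply Hc; lia]. }
  (* the index of [a k] in [b] is at least [k], for both orders of the two sequences *)
  assert (Le : forall a b, enumerates_positive_zeros f a -> enumerates_positive_zeros f b ->
            forall k, (1 <= k)%nat -> b k <= a k).
  { intros c d [Mc Zc] [Md Zd] k.
    assert (Ix : forall i, (1 <= i)%nat -> exists j, (i <= j)%nat /\ c i = d j).
    { intros i Hi. induction Hi as [|i Hi IH].
      - destruct (proj1 (Zd (c 1%nat))) as [j [Hj E]]; [apply Zc; now exists 1%nat|].
        now exists j.
      - destruct IH as [j [Hj E]].
        destruct (proj1 (Zd (c (S i)))) as [l [Hl E']];
          [apply Zc; exists (S i); split; [lia|easy]|].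
        exists l. split; [|exact E'].
        specialize (Mc i Hi). destruct (Compare_dec.le_lt_dec l j) as [Hlj|Hlj]; [|lia].
        destruct (Nat.eq_dec l j) as [->|Hn]; [lra|].
        pose proof (Mono d Md l j Hl ltac:(lia)). lra. }
    intros Hk. destruct (Ix k Hk) as [j [Hj ->]].
    destruct (Nat.eq_dec k j) as [->|Hn]; [lra|]. left. apply Mono; auto. lia. }
  intros Ha Hb k Hk. apply Rle_antisym; [apply (Le b a)|apply (Le a b)]; auto.
Qed.

(** Only the identification of the zeros with the gains [k PI] matters, so [f] stands for
    the cross-product.  Positive zeros have [k >= 1] because [th] increases. *)
Lemma phase_enumeration (nu L : R) (th M f : R -> R) :
  phase (bessel_potential nu) th M -> 0 < L ->
  (forall s, f (2 * exp s) = 0 <-> sin (th (s + L) - th s) = 0) ->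
  exists a, enumerates_positive_zeros f a /\
    forall k, (1 <= k)%nat -> exists s, a k = 2 * exp s /\ th (s + L) - th s = INR k * PI.
Proof.
  intros H HL Hf. pose proof PI_RGT_0 as Hpi.
  set (P := fun (k : nat) (s : R) => (1 <= k)%nat -> th (s + L) - th s = INR k * PI).
  set (sg := fun k => epsilon (inhabits 0) (P k)).
  assert (Hsg : forall k, (1 <= k)%nat -> th (sg k + L) - th (sg k) = INR k * PI).
  { intros k Hk. assert (S : P k (sg k)); [|now apply S].
    apply epsilon_spec. destruct (window_gain_level nu th M L k H HL Hk) as [s Hs].
    now exists s. }
  assert (Lt : forall s t (j k : nat), (1 <= j <= k)%nat -> th (s + L) - th s = INR j * PI ->
            th (t + L) - th t = INR k * PI -> s <= t).
  { intros s t j k Hjk Hs Ht. apply Rnot_lt_le. intros Hts.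
    assert (INR j * PI < th (s + L) - th s); [|lra].
    apply (window_gain_increasing (bessel_potential nu) th M L t s); auto; try lia.
    - apply bessel_potential_increasing.
    - rewrite Ht. apply Rmult_le_compat_r; [lra|apply le_INR; lia]. }
  exists (fun k => 2 * exp (sg k)). split; [split|].
  - intros k Hk. apply Rmult_lt_compat_l; [lra|]. apply exp_increasing.
    pose proof (Hsg k Hk) as E. pose proof (Hsg (S k) ltac:(lia)) as E'.
    destruct (Lt _ _ k (S k) ltac:(lia) E E') as [|Eq]; [easy|].
    rewrite Eq, E', S_INR in E. lra.
  - intros z. split.
    + intros [Hz Hf0]. set (s := ln (z / 2)).
      assert (Ez : z = 2 * exp s) by (unfold s; rewrite exp_ln; lra).
      rewrite Ez in Hf0. apply Hf in Hf0.
      assert (0 < th (s + L) - th s).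
      { assert (th s < th (s + L)); [|lra]. apply H. lra. }
      destruct (sin_zero_nat _ H0 Hf0) as [k [Hk E]].
      exists k. split; [exact Hk|]. rewrite Ez. do 2 f_equal.
      apply Rle_antisym; [apply (Lt _ _ k k)|apply (Lt _ _ k k)]; auto.
    + intros [k [Hk ->]]. split.
      * pose proof (exp_pos (sg k)). lra.
      * apply Hf. rewrite (Hsg k Hk). apply sin_nat_PI.
  - intros k Hk. exists (sg k). split; [easy|]. now apply Hsg.
Qed.

(** * The function [sqrt (1 - r^2) - r acos r] and the limiting equation *)

(** [t * wkb (x / t)] is a primitive in [t] of [sqrt (t^2 - x^2) / t]; both vanish
    for [t <= x], because [sqrt] vanishes on negative numbers and [acos] beyond [1]. *)
Definition wkb (r : R) : R := sqrt (1 - r ^ 2) - r * acos r.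

Lemma acos_ge_1 (r : R) : 1 <= r -> acos r = 0.
Proof.
  intros H. unfold acos. destruct (Rle_dec r (-1)); [lra|]. destruct (Rle_dec 1 r); lra.
Qed.

Lemma wkb_ge_1 (r : R) : 1 <= r -> wkb r = 0.
Proof.
  intros H. unfold wkb. rewrite acos_ge_1 by exact H.
  rewrite sqrt_neg_0; [ring|].
  assert (1 * 1 <= r * r) by (apply Rmult_le_compat; lra). simpl. lra.
Qed.

Lemma one_minus_sq_pos (r : R) : -1 < r < 1 -> 0 < 1 - r ^ 2.
Proof.
  intros H. replace (1 - r ^ 2) with ((1 - r) * (1 + r)) by ring.
  apply Rmult_lt_0_compat; lra.
Qed.

Lemma is_derive_acos (r : R) : -1 < r < 1 -> is_derive acos r (- / sqrt (1 - r ^ 2)).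
Proof.
  intros H. apply is_derive_Reals.
  replace (- / sqrt (1 - r ^ 2)) with (-1 / sqrt (1 - r²)).
  - apply derive_pt_eq_1 with (derivable_pt_acos r H). apply derive_pt_acos.
  - unfold Rsqr. simpl. rewrite Rmult_1_r. unfold Rdiv. ring.
Qed.

Lemma acos_small (eps : R) : 0 < eps -> exists d, 0 < d /\ forall r, 1 - d < r -> acos r < eps.
Proof.
  intros He. pose proof PI_RGT_0 as Hpi.
  set (e := Rmin eps (PI / 2)).
  assert (e <= eps) by apply Rmin_l. assert (e <= PI / 2) by apply Rmin_r.
  assert (0 < e) by (apply Rmin_glb_lt; lra).
  assert (cos e < 1) by (rewrite <- cos_0; apply cos_decreasing_1; lra).
  assert (0 <= cos e) by (apply cos_ge_0; lra).
  exists (1 - cos e). split; [lra|]. intros r Hr.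
  destruct (Rle_lt_dec 1 r) as [Hr1|Hr1]; [rewrite acos_ge_1; lra|].
  apply Rnot_le_lt. intros Hle.
  assert (cos (acos r) <= cos e).
  { pose proof (acos_bound r). apply cos_decr_1; lra. }
  rewrite cos_acos in H4; lra.
Qed.

Lemma acos_continuous (r : R) : -1 < r -> continuity_pt acos r.
Proof.
  intros H. destruct (Rtotal_order r 1) as [L|[L|L]].
  - eapply is_derive_continuity_pt, is_derive_acos. lra.
  - subst r. intros eps He. destruct (acos_small eps He) as [d [Hd Hs]].
    exists d. split; [exact Hd|]. intros x [_ Hx].
    unfold Base, R_met, Rdist, dist in *. rewrite acos_1, Rminus_0_r.
    rewrite Rabs_pos_eq by apply acos_bound.
    apply Hs. apply Rabs_def2 in Hx. lra.
  - apply (is_derive_continuity_pt _ r 0).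
    apply (is_derive_ext_loc (fun _ => 0)); [|apply @is_derive_const].
    apply (filter_imp (fun x => 1 < x)); [intros x Hx; symmetry; apply acos_ge_1; lra|].
    now apply (open_gt 1).
Qed.

Lemma wkb_continuous (r : R) : -1 < r -> continuity_pt wkb r.
Proof.
  intros H. apply continuity_pt_minus.
  - apply continuity_pt_filterlim.
    apply (continuous_comp (fun r => 1 - r ^ 2) sqrt); [|apply continuous_sqrt].
    apply (ex_derive_continuous (fun r : R => 1 - r ^ 2)). auto_derive. easy.
  - apply continuity_pt_mult; [apply derivable_continuous_pt, derivable_pt_id|].
    now apply acos_continuous.
Qed.

(** At the turning point [r = 1] the mean value theorem on [[r, 1]] bounds the
    difference quotient by a value of [acos] near [1]. *)
Lemma is_derive_wkb (r : R) : -1 < r -> is_derive wkb r (- acos r).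
Proof.
  assert (In : forall r, -1 < r < 1 -> is_derive wkb r (- acos r)).
  { intros x Hx. pose proof (one_minus_sq_pos x Hx) as P.
    assert (0 < sqrt (1 - x ^ 2)) by now apply sqrt_lt_R0.
    pose proof (is_derive_acos x Hx) as D.
    unfold wkb. auto_derive.
    - repeat split; [simpl in P; lra|now exists (- / sqrt (1 - x ^ 2))].
    - rewrite (is_derive_unique (fun x : R => acos x) _ _ D).
      replace (1 + - (x * (x * 1))) with (1 - x ^ 2) by ring. field. lra. }
  intros H. destruct (Rtotal_order r 1) as [L|[L|L]].
  - apply In. lra.
  - subst r. rewrite acos_1, Ropp_0. apply is_derive_Reals.
    intros eps He. destruct (acos_small eps He) as [d [Hd Hs]].
    assert (Hd' : 0 < Rmin d 1) by (apply Rmin_glb_lt; lra).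
    exists (mkposreal _ Hd'). simpl. intros h Hh0 Hh.
    pose proof (Rmin_l d 1). pose proof (Rmin_r d 1).
    rewrite (wkb_ge_1 1) by lra. rewrite !Rminus_0_r.
    destruct (Rle_lt_dec 0 h) as [Hp|Hn].
    + rewrite wkb_ge_1 by lra. unfold Rdiv. rewrite Rmult_0_l, Rabs_R0. exact He.
    + apply Rabs_def2 in Hh.
      destruct (MVT_derive_open wkb (fun x => - acos x) (1 + h) 1) as [c [Hc E]].
      * lra.
      * intros x Hx. apply In. lra.
      * intros x Hx. apply wkb_continuous. lra.
      * rewrite (wkb_ge_1 1) in E by lra.
        replace (wkb (1 + h)) with (- acos c * h) by lra.
        replace (- acos c * h / h) with (- acos c) by (field; exact Hh0).
        rewrite Rabs_Ropp, Rabs_pos_eq by apply acos_bound. apply Hs. lra.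
  - rewrite acos_ge_1, Ropp_0 by lra.
    apply (is_derive_ext_loc (fun _ => 0)); [|apply @is_derive_const].
    apply (filter_imp (fun x => 1 < x)); [intros x Hx; symmetry; apply wkb_ge_1; lra|].
    now apply (open_gt 1).
Qed.

(** [y * action rho (x / y)] is [∫ sqrt (max (y^2 - x^2 / r^2, 0)) dr] over
    [1 <= r <= rho]: the growth of the phase, per unit of the large parameter, that the
    semiclassical approximation predicts. *)
Definition action (rho r : R) : R := rho * wkb (r / rho) - wkb r.

Definition action_slope (rho r : R) : R :=
  rho * sqrt (1 - (r / rho) ^ 2) - sqrt (1 - r ^ 2).

Lemma div_gt_m1 (rho r : R) : 1 < rho -> -1 < r -> -1 < r / rho.
Proof.
  intros Hrho Hr. apply (Rmult_lt_reg_r rho); [lra|].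
  unfold Rdiv. rewrite Rmult_assoc, Rinv_l by lra. lra.
Qed.

Lemma is_derive_action (rho r : R) :
  1 < rho -> -1 < r -> is_derive (action rho) r (acos r - acos (r / rho)).
Proof.
  intros Hrho Hr. unfold action.
  pose proof (is_derive_wkb r Hr) as D1.
  pose proof (is_derive_wkb (r / rho) (div_gt_m1 _ _ Hrho Hr)) as D2.
  unfold Rdiv in *. auto_derive.
  - repeat split; eexists; eassumption.
  - rewrite (is_derive_unique (fun x : R => wkb x) _ _ D1).
    rewrite (is_derive_unique (fun x : R => wkb x) _ _ D2).
    field. lra.
Qed.

(** The partial derivative of [y * action rho (x / y)] in [y]. *)
Lemma action_slope_eq (rho r : R) :
  1 < rho -> action rho r - r * (acos r - acos (r / rho)) = action_slope rho r.
Proof.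
  intros H. unfold action, action_slope, wkb. field. lra.
Qed.

Lemma action_slope_pos (rho r : R) : 1 < rho -> -1 < r < rho -> 0 < action_slope rho r.
Proof.
  intros H Hr. unfold action_slope.
  assert (E : rho * sqrt (1 - (r / rho) ^ 2) = sqrt (rho ^ 2 - r ^ 2)).
  { rewrite <- (sqrt_pow2 rho) at 1 by lra. rewrite <- sqrt_mult_alt by apply pow2_ge_0.
    f_equal. field. lra. }
  rewrite E. assert (1 < rho ^ 2).
  { simpl. rewrite Rmult_1_r. rewrite <- (Rmult_1_l 1). apply Rmult_le_0_lt_compat; lra. }
  destruct (Rle_lt_dec 1 r) as [Hr1|Hr1].
  - assert (1 * 1 <= r * r) by (apply Rmult_le_compat; lra).
    rewrite (sqrt_neg_0 (1 - r ^ 2)) by (simpl; lra).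
    assert (r * r < rho * rho) by (apply Rmult_le_0_lt_compat; lra).
    assert (0 < sqrt (rho ^ 2 - r ^ 2)); [|lra]. apply sqrt_lt_R0. simpl. lra.
  - pose proof (one_minus_sq_pos r (conj (proj1 Hr) Hr1)).
    assert (sqrt (1 - r ^ 2) < sqrt (rho ^ 2 - r ^ 2)) by (apply sqrt_lt_1_alt; lra). lra.
Qed.

Lemma action_even (rho r : R) : 1 < rho -> action rho (- r) = action rho r.
Proof.
  intros H. unfold action, wkb.
  replace (- r / rho) with (- (r / rho)) by (field; lra).
  rewrite !acos_opp. rewrite <- !Rsqr_pow2, <- !Rsqr_neg. field. lra.
Qed.

Lemma action_pos (rho r : R) : 1 < rho -> -1 < r < rho -> 0 < action rho r.
Proof.
  intros H.
  assert (Pos : forall r, 0 < r < rho -> 0 < action rho r).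
  { intros x Hx.
    assert (- action rho x < - action rho rho).
    { apply (derive_pos_increasing (fun x => - action rho x)
               (fun x => - (acos x - acos (x / rho)))); [lra| | |].
      - intros t Ht. apply (is_derive_opp (action rho)), is_derive_action; lra.
      - intros t Ht. apply continuity_pt_opp.
        apply (is_derive_continuity_pt _ _ _ (is_derive_action rho t H ltac:(lra))).
      - intros t Ht.
        assert (0 < t / rho < 1).
        { split; [apply Rdiv_lt_0_compat; lra|].
          apply (Rmult_lt_reg_r rho); [lra|]. unfold Rdiv.
          rewrite Rmult_assoc, Rinv_l by lra. lra. }
        assert (t / rho < t).
        { apply (Rmult_lt_reg_r rho); [lra|]. unfold Rdiv.
          rewrite Rmult_assoc, Rinv_l, Rmult_1_r by lra.
          rewrite <- (Rmult_1_r t) at 1. apply Rmult_lt_compat_l; lra. }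
        assert (0 < acos (t / rho)) by (apply acos_bound_lt; lra).
        assert (acos t < acos (t / rho)); [|lra].
        destruct (Rle_lt_dec 1 t) as [Ht1|Ht1]; [rewrite acos_ge_1; lra|].
        pose proof (acos_bound t). pose proof (acos_bound (t / rho)).
        apply cos_decreasing_0; try lra. rewrite !cos_acos; lra. }
    assert (action rho rho = 0); [|lra].
    unfold action. rewrite !wkb_ge_1; try lra.
    right. field. lra. }
  intros Hr. destruct (Rtotal_order r 0) as [L|[->|L]].
  - rewrite <- action_even by exact H. apply Pos. lra.
  - unfold action, wkb. replace (1 - (0 / rho) ^ 2) with 1 by (field; lra).
    replace (1 - 0 ^ 2) with 1 by ring. rewrite sqrt_1. unfold Rdiv. lra.
  - apply Pos. lra.
Qed.

Lemma action_0 (rho : R) : 1 < rho -> action rho 0 = rho - 1.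
Proof.
  intros H. unfold action, wkb. replace (1 - (0 / rho) ^ 2) with 1 by (field; lra).
  replace (1 - 0 ^ 2) with 1 by ring. rewrite sqrt_1. unfold Rdiv. ring.
Qed.

Lemma ratio_bounds (rho x y : R) : 1 < rho -> 0 <= x -> x / rho < y -> 0 < y /\ 0 <= x / y < rho.
Proof.
  intros H Hx Hy.
  assert (0 <= x / rho) by (apply Rdiv_le_0_compat; lra).
  assert (0 < y) by lra. split; [easy|]. split; [now apply Rdiv_le_0_compat|].
  apply (Rmult_lt_reg_r (y / rho)); [apply Rdiv_lt_0_compat; lra|].
  replace (x / y * (y / rho)) with (x / rho) by (field; lra).
  replace (rho * (y / rho)) with y by (field; lra). exact Hy.
Qed.

Lemma action_increasing (rho x y1 y2 : R) :
  1 < rho -> 0 <= x -> x / rho < y1 -> y1 < y2 ->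
  y1 * action rho (x / y1) < y2 * action rho (x / y2).
Proof.
  intros H Hx Hy1 Hy.
  assert (D : forall y, x / rho < y ->
            is_derive (fun y => y * action rho (x / y)) y (action_slope rho (x / y))).
  { intros y Hy'. destruct (ratio_bounds rho x y H Hx Hy') as [Py Pr].
    pose proof (is_derive_action rho (x / y) H ltac:(lra)) as Da.
    rewrite <- action_slope_eq by exact H. unfold Rdiv in Da |- *. auto_derive.
    - repeat split; [eexists; eassumption|lra].
    - rewrite (is_derive_unique (fun t : R => action rho t) _ _ Da). field. lra. }
  apply (derive_pos_increasing (fun y => y * action rho (x / y))
           (fun y => action_slope rho (x / y))); auto.
  - intros y Hy'. apply D. lra.
  - intros y Hy'. eapply is_derive_continuity_pt, D. lra.
  - intros y Hy'. destruct (ratio_bounds rho x y H Hx ltac:(lra)).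
    apply action_slope_pos; lra.
Qed.

Lemma Ac_acos (t : R) : 0 <= t -> Ac t = acos t.
Proof.
  intros H. unfold Ac. destruct (Rle_dec (Rabs t) 1) as [|N]; [easy|].
  rewrite acos_ge_1; [easy|]. rewrite Rabs_pos_eq in N by exact H. lra.
Qed.

Lemma Sr_sqrt (t : R) : Sr t = sqrt t.
Proof.
  unfold Sr. destruct (Rle_dec 0 t); [easy|]. rewrite sqrt_neg_0; lra.
Qed.

Lemma ode_rhs_action (rho x y : R) : 1 < rho -> 0 <= x -> x / rho < y ->
  ode_rhs rho x y = - (acos (x / y) - acos (x / y / rho)) / action_slope rho (x / y).
Proof.
  intros H Hx Hy. destruct (ratio_bounds rho x y H Hx Hy) as [Py Pr].
  unfold ode_rhs, action_slope. rewrite Ac_acos, Sr_sqrt by lra.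
  replace (x / y / rho) with (x / (rho * y)) by (field; lra).
  f_equal. ring.
Qed.

Lemma D_in_is_derive (f df : R -> R) (x : R) :
  0 < x -> D_in f df (fun t => 0 <= t) x -> is_derive f x (df x).
Proof.
  intros Hx H. apply is_derive_Reals. intros eps He.
  destruct (H eps He) as [d [Hd Hl]].
  assert (P : 0 < Rmin d x) by (apply Rmin_glb_lt; lra).
  exists (mkposreal _ P). simpl. intros h Hh0 Hh.
  pose proof (Rmin_l d x). pose proof (Rmin_r d x).
  specialize (Hl (x + h)). simpl in Hl. unfold Rdist in Hl.
  replace (x + h - x) with h in Hl by ring. apply Hl.
  split; [|lra]. apply Rabs_def2 in Hh. split; lra.
Qed.

Lemma is_derive_D_in (f df : R -> R) (D : R -> Prop) (x : R) :
  is_derive f x (df x) -> D_in f df D x.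
Proof.
  intros H eps He. apply is_derive_Reals in H.
  destruct (H eps He) as [d Hd]. exists d. split; [apply cond_pos|].
  intros t [[_ Ht] Hd']. simpl in *. unfold Rdist in *.
  specialize (Hd (t - x) ltac:(lra) Hd'). now replace (x + (t - x)) with t in Hd by ring.
Qed.

(** The equation says that the level sets of [y * action rho (x / y)] contain its
    solutions. *)
Lemma ivp_solution_level (rho : R) (y : R -> R) :
  1 < rho -> ivp_solution rho y ->
  forall x, 0 <= x -> y x * action rho (x / y x) = PI.
Proof.
  intros H [Y0 [Yr Yd]] x Hx.
  assert (E0 : y 0 * action rho (0 / y 0) = PI).
  { replace (0 / y 0) with 0 by (unfold Rdiv; ring).
    rewrite action_0, Y0 by exact H. field. lra. }
  destruct (Req_dec x 0) as [->|Nx]; [exact E0|].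
  rewrite <- E0.
  (* the even extension in [t] makes the function two-sided continuous at 0 *)
  set (F := fun t => y (Rabs t) * action rho (Rabs t / y (Rabs t))).
  replace (y x * action rho (x / y x)) with (F x)
    by (unfold F; rewrite Rabs_pos_eq; [easy|lra]).
  replace (y 0 * action rho (0 / y 0)) with (F 0) by (unfold F; now rewrite Rabs_R0).
  assert (Cy : forall t, 0 <= t -> continuity_pt (fun t => y (Rabs t)) t).
  { intros t Ht. destruct (Req_dec t 0) as [->|N].
    - intros eps He.
      destruct (cont_deriv y _ _ 0 (Yd 0 ltac:(lra)) eps He) as [d [Hd Hc]].
      exists d. split; [exact Hd|]. intros s [[_ Hs] Hsd].
      rewrite Rabs_R0. apply Hc. simpl in *. unfold Rdist in *.
      rewrite Rminus_0_r in *. rewrite Rabs_Rabsolu. split; [|exact Hsd].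
      split; [apply Rabs_pos|]. assert (Rabs s <> 0) by (apply Rabs_no_R0; lra). lra.
    - apply (continuity_pt_comp Rabs y); [apply Rcontinuity_abs|].
      rewrite Rabs_pos_eq by exact Ht.
      apply (is_derive_continuity_pt _ t (ode_rhs rho t (y t))).
      apply (D_in_is_derive y (fun t => ode_rhs rho t (y t))); [lra|apply Yd, Ht]. }
  assert (CF : forall t, 0 <= t -> continuity_pt F t).
  { intros t Ht. destruct (ratio_bounds rho t (y t) H Ht (Yr t Ht)) as [Py Pr].
    apply continuity_pt_mult; [now apply Cy|].
    apply (continuity_pt_comp (fun t => Rabs t / y (Rabs t)) (action rho)).
    - apply continuity_pt_div; [apply Rcontinuity_abs|now apply Cy|].
      rewrite Rabs_pos_eq; lra.
    - rewrite Rabs_pos_eq by exact Ht.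
      apply (is_derive_continuity_pt _ _ _ (is_derive_action rho (t / y t) H ltac:(lra))). }
  assert (DF : forall t, 0 < t -> is_derive F t 0).
  { intros t Ht.
    apply (is_derive_ext_loc (fun t => y t * action rho (t / y t))).
    { apply (filter_imp (fun t => 0 < t)); [|now apply (open_gt 0)].
      intros s Hs. unfold F. rewrite Rabs_pos_eq; [easy|lra]. }
    destruct (ratio_bounds rho t (y t) H ltac:(lra) (Yr t ltac:(lra))) as [Py Pr].
    pose proof (D_in_is_derive y _ t Ht (Yd t ltac:(lra))) as Dy. cbv beta in Dy.
    pose proof (is_derive_action rho (t / y t) H ltac:(lra)) as Da.
    pose proof (action_slope_pos rho (t / y t) H ltac:(lra)) as Sp.
    pose proof (action_slope_eq rho (t / y t) H) as Se.
    rewrite (ode_rhs_action rho t (y t) H ltac:(lra) (Yr t ltac:(lra))) in Dy.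
    unfold Rdiv in *. auto_derive.
    - repeat split; try (eexists; eassumption). lra.
    - rewrite (is_derive_unique (fun t : R => action rho t) _ _ Da).
      rewrite (is_derive_unique (fun t : R => y t) _ _ Dy).
      replace (action rho (t * / y t)) with
        (action_slope rho (t * / y t) + t * / y t * (acos (t * / y t) - acos (t * / y t * / rho)))
        by lra.
      field. lra. }
  destruct (MVT_derive_open F (fun _ => 0) 0 x) as [c [_ E]].
  - lra.
  - intros t Ht. apply DF. lra.
  - intros t Ht. apply CF. lra.
  - lra.
Qed.

Lemma ivp_solution_unique (rho : R) (y1 y2 : R -> R) :
  1 < rho -> ivp_solution rho y1 -> ivp_solution rho y2 ->
  forall x, 0 <= x -> y1 x = y2 x.
Proof.
  intros H S1 S2 x Hx.
  pose proof (ivp_solution_level rho y1 H S1 x Hx).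
  pose proof (ivp_solution_level rho y2 H S2 x Hx).
  destruct S1 as [_ [R1 _]]. destruct S2 as [_ [R2 _]].
  destruct (Rtotal_order (y1 x) (y2 x)) as [L|[L|L]]; [exfalso|exact L|exfalso].
  - pose proof (action_increasing rho x _ _ H Hx (R1 x Hx) L). lra.
  - pose proof (action_increasing rho x _ _ H Hx (R2 x Hx) L). lra.
Qed.

(** The derivative of an inverse function, in a form that asks nothing of [g] but
    to pick preimages inside the interval. *)
Lemma is_derive_inverse (f df g : R -> R) (a b x : R) :
  (forall r, a < r < b -> is_derive f r (df r)) ->
  (forall r, a < r < b -> 0 < df r) ->
  locally x (fun t => a < g t < b /\ f (g t) = t) ->
  is_derive g x (/ df (g x)).
Proof.
  intros Df Pf Hg.
  pose proof (locally_singleton _ _ Hg) as [G0 F0].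
  assert (Inc : forall r s, a < r -> s < b -> r < s -> f r < f s).
  { intros r s Hr Hs Hrs. apply (derive_pos_increasing f df r s); auto.
    - intros t Ht. apply Df. lra.
    - intros t Ht. apply (is_derive_continuity_pt _ _ _ (Df t ltac:(lra))).
    - intros t Ht. apply Pf. lra. }
  assert (Cg : continuous g x).
  { apply filterlim_locally. intros eps.
    set (r1 := Rmax (g x - eps) ((a + g x) / 2)). set (r2 := Rmin (g x + eps) ((g x + b) / 2)).
    pose proof (cond_pos eps).
    assert (B1 : a < r1 < g x).
    { split; [apply Rlt_le_trans with ((a + g x) / 2); [lra|apply Rmax_r]|apply Rmax_lub_lt; lra]. }
    assert (B2 : g x < r2 < b).
    { split; [apply Rmin_glb_lt; lra|apply Rle_lt_trans with ((g x + b) / 2); [apply Rmin_r|lra]]. }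
    assert (f r1 < x < f r2).
    { rewrite <- F0. split; apply Inc; lra. }
    generalize (filter_and _ _ Hg (filter_and _ _ (open_gt (f r1) x (proj1 H0))
                                     (open_lt (f r2) x (proj2 H0)))).
    apply filter_imp. intros t [[Gt Ft] [T1 T2]].
    assert (r1 < g t).
    { apply Rnot_le_lt. intros [L|L]; [pose proof (Inc (g t) r1 ltac:(lra) ltac:(lra) L); lra|].
      rewrite <- L in T1. lra. }
    assert (g t < r2).
    { apply Rnot_le_lt. intros [L|L]; [pose proof (Inc r2 (g t) ltac:(lra) ltac:(lra) L); lra|].
      rewrite L in T2. lra. }
    pose proof (Rmax_l (g x - eps) ((a + g x) / 2)) as M1. fold r1 in M1.
    pose proof (Rmin_l (g x + eps) ((g x + b) / 2)) as M2. fold r2 in M2.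
    apply Rabs_def1; unfold minus, plus, opp; simpl; lra. }
  apply is_derive_Reals. intros eps He.
  pose proof (Pf _ G0) as P0. pose proof (Df _ G0) as D0. apply is_derive_Reals in D0.
  assert (Ci : continuous Rinv (df (g x))).
  { apply continuous_Rinv. lra. }
  destruct (proj1 (filterlim_locally _ _) Ci (mkposreal eps He)) as [e1 H1].
  destruct (D0 e1 (cond_pos e1)) as [d1 Hd1].
  destruct (proj1 (filterlim_locally _ _) Cg d1) as [d2 H2].
  destruct Hg as [d3 H3].
  assert (P : 0 < Rmin d2 d3) by (apply Rmin_glb_lt; apply cond_pos).
  exists (mkposreal _ P). simpl. intros h Hh0 Hh.
  assert (Bh : forall d : posreal, Rabs h < d -> ball x d (x + h)).
  { intros d Hd. unfold ball; simpl. unfold AbsRing_ball, abs, minus, plus, opp; simpl.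
    now replace (x + h + - x) with h by ring. }
  specialize (H2 (x + h) (Bh d2 (Rlt_le_trans _ _ _ Hh (Rmin_l _ _)))).
  destruct (H3 (x + h) (Bh d3 (Rlt_le_trans _ _ _ Hh (Rmin_r _ _)))) as [_ F1].
  set (k := g (x + h) - g x).
  assert (Ek : g (x + h) = g x + k) by (unfold k; ring).
  assert (Nk : k <> 0).
  { intros E. rewrite Ek, E, Rplus_0_r, F0 in F1. lra. }
  specialize (Hd1 k Nk H2).
  rewrite <- Ek, F1, F0 in Hd1. replace (x + h - x) with h in Hd1 by ring.
  specialize (H1 (h / k) Hd1).
  replace (k / h) with (/ (h / k)) by (field; lra).
  exact H1.
Qed.

(** By homogeneity the level curve [y * action rho (x / y) = PI] is parametrised by
    [r = x / y]: it is [y = PI / action rho r], [x = r y].  The parameter range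
    starts below [0], so the solution is differentiable at [x = 0] from both sides. *)
Lemma ivp_solution_exists (rho : R) : 1 < rho -> exists alpha, ivp_solution rho alpha.
Proof.
  intros H. pose proof PI_RGT_0 as Hpi.
  set (X := fun r => PI * r / action rho r).
  set (dX := fun r => PI * action_slope rho r / (action rho r) ^ 2).
  assert (DX : forall r, -1 < r < rho -> is_derive X r (dX r)).
  { intros r Hr. pose proof (action_pos rho r H Hr) as P.
    pose proof (is_derive_action rho r H (proj1 Hr)) as D.
    unfold X, dX. auto_derive.
    - repeat split; [eexists; eassumption|lra].
    - rewrite (is_derive_unique (fun t : R => action rho t) _ _ D).
      rewrite <- action_slope_eq by exact H. field. lra. }
  assert (PX : forall r, -1 < r < rho -> 0 < dX r).
  { intros r Hr. pose proof (action_pos rho r H Hr). pose proof (action_slope_pos rho r H Hr).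
    unfold dX. apply Rdiv_lt_0_compat; [apply Rmult_lt_0_compat; lra|now apply pow_lt]. }
  pose proof (action_pos rho (- / 2) H ltac:(lra)) as Ph.
  set (x0 := PI / 2 / action rho (- / 2)).
  assert (Hx0 : 0 < x0) by (apply Rdiv_lt_0_compat; lra).
  assert (Ex : forall x, - x0 < x -> exists r, -1 < r < rho /\ X r = x).
  { intros x Hx.
    assert (C : forall r, - / 2 <= r <= rho -> continuity_pt (fun r => PI * r - x * action rho r) r).
    { intros r Hr. pose proof (is_derive_action rho r H ltac:(lra)) as D.
      eapply is_derive_continuity_pt. auto_derive; [eexists; eassumption|reflexivity]. }
    destruct (IVT_interv _ _ _ C) as [r [Hr E]].
    - lra.
    - assert (- x0 * action rho (- / 2) < x * action rho (- / 2)) by now apply Rmult_lt_compat_r.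
      replace (- x0 * action rho (- / 2)) with (PI * - / 2) in H0 by (unfold x0; field; lra).
      lra.
    - unfold action. rewrite !wkb_ge_1; [|lra|right; field; lra].
      assert (0 < PI * rho) by (apply Rmult_lt_0_compat; lra). lra.
    - assert (r <> rho).
      { intros ->. unfold action in E. rewrite !wkb_ge_1 in E; [|lra|right; field; lra].
        assert (0 < PI * rho) by (apply Rmult_lt_0_compat; lra). lra. }
      pose proof (action_pos rho r H ltac:(lra)).
      exists r. split; [lra|]. unfold X.
      replace (PI * r) with (x * action rho r) by lra. field. lra. }
  set (g := fun x => epsilon (inhabits 0) (fun r => -1 < r < rho /\ X r = x)).
  assert (Hg : forall x, - x0 < x -> -1 < g x < rho /\ X (g x) = x).
  { intros x Hx. apply (epsilon_spec (inhabits 0) (fun r => -1 < r < rho /\ X r = x)), Ex, Hx. }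
  assert (Dg : forall x, - x0 < x -> is_derive g x (/ dX (g x))).
  { intros x Hx. apply (is_derive_inverse X dX g (-1) rho); auto.
    apply (filter_imp (fun t => - x0 < t)); [apply Hg|now apply (open_gt (- x0))]. }
  set (alpha := fun x => PI / action rho (g x)).
  assert (Pa : forall x, - x0 < x -> 0 < action rho (g x)).
  { intros x Hx. apply action_pos; [exact H|apply Hg, Hx]. }
  assert (Ra : forall x, - x0 < x -> x / alpha x = g x).
  { intros x Hx. destruct (Hg x Hx) as [_ E]. unfold alpha.
    rewrite <- E at 1. unfold X. specialize (Pa x Hx). field. lra. }
  assert (La : forall x, 0 <= x -> x / rho < alpha x).
  { intros x Hx. destruct (Hg x ltac:(lra)) as [B E]. specialize (Pa x ltac:(lra)).
    assert (0 < alpha x) by (apply Rdiv_lt_0_compat; lra).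
    rewrite <- (Ra x ltac:(lra)) in B.
    apply (Rmult_lt_reg_r (rho / alpha x)); [apply Rdiv_lt_0_compat; lra|].
    replace (x / rho * (rho / alpha x)) with (x / alpha x) by (field; lra).
    replace (alpha x * (rho / alpha x)) with rho by (field; lra). lra. }
  exists alpha. split; [|split].
  - destruct (Hg 0 ltac:(lra)) as [B E]. specialize (Pa 0 ltac:(lra)).
    assert (g 0 = 0) as E0.
    { rewrite <- (Ra 0) by lra. unfold Rdiv. ring. }
    unfold alpha. now rewrite E0, action_0.
  - exact La.
  - intros x Hx. apply is_derive_D_in.
    rewrite (ode_rhs_action rho x (alpha x) H Hx (La x Hx)), Ra by lra.
    destruct (Hg x ltac:(lra)) as [B E]. specialize (Pa x ltac:(lra)).
    pose proof (is_derive_action rho (g x) H (proj1 B)) as D.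
    pose proof (Dg x ltac:(lra)) as D'.
    pose proof (action_slope_pos rho (g x) H B).
    unfold alpha. auto_derive.
    + repeat split; try (eexists; eassumption). lra.
    + rewrite (is_derive_unique (fun t : R => action rho t) _ _ D).
      rewrite (is_derive_unique (fun t : R => g t) _ _ D').
      unfold dX. field. lra.
Qed.

(** * Semiclassical asymptotics of the phase *)

(** The classical momentum in the variable [s = ln t].  It vanishes left of the turning
    point [t = x], because [sqrt] does on negative numbers. *)
Definition momentum (x s : R) : R := sqrt (exp s ^ 2 - x ^ 2).

Definition wkb_phase (x s : R) : R := exp s * wkb (x / exp s).

Lemma momentum_increasing (x s t : R) : s <= t -> momentum x s <= momentum x t.
Proof.
  intros H. apply sqrt_le_1_alt. pose proof (exp_pos s).
  assert (exp s <= exp t).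
  { destruct H as [H| ->]; [left; now apply exp_increasing|lra]. }
  assert (exp s ^ 2 <= exp t ^ 2); [|lra]. apply pow_incr. lra.
Qed.

Lemma is_derive_wkb_phase (x s : R) : 0 <= x -> is_derive (wkb_phase x) s (momentum x s).
Proof.
  intros Hx. pose proof (exp_pos s) as P.
  assert (0 <= x / exp s) by (apply Rdiv_le_0_compat; lra).
  pose proof (is_derive_wkb (x / exp s) ltac:(lra)) as D.
  assert (E : momentum x s = exp s * sqrt (1 - (x / exp s) ^ 2)).
  { unfold momentum. rewrite <- (sqrt_pow2 (exp s)) at 2 by lra.
    rewrite <- sqrt_mult_alt by apply pow2_ge_0. f_equal. field. lra. }
  rewrite E. unfold wkb_phase, Rdiv in *. auto_derive.
  - repeat split; [eexists; eassumption|lra].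
  - rewrite (is_derive_unique (fun t : R => wkb t) _ _ D). unfold wkb. field. lra.
Qed.

Lemma wkb_phase_step (x s l : R) : 0 <= x -> 0 < l ->
  l * momentum x s <= wkb_phase x (s + l) - wkb_phase x s <= l * momentum x (s + l).
Proof.
  intros Hx Hl.
  destruct (MVT_derive (wkb_phase x) (momentum x) s (s + l)) as [c [Hc E]].
  - lra.
  - intros t _. now apply is_derive_wkb_phase.
  - replace (s + l - s) with l in E by ring. rewrite E, (Rmult_comm _ l).
    split; apply Rmult_le_compat_l; try lra; apply momentum_increasing; lra.
Qed.

(** On one cell of a partition the potential is compared with its values at the two
    ends, which costs at most one half-turn per cell; as the momentum is monotone,
    the errors of the Riemann sums telescope. *)
Lemma partition_upper (Q th M : R -> R) (k x a l : R) (n : nat) :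
  phase Q th M -> (forall s, Q s = k ^ 2 * (exp s ^ 2 - x ^ 2)) -> 0 < k -> 0 <= x -> 0 < l ->
  th (a + INR n * l) - th a <=
    k * (wkb_phase x (a + INR n * l) - wkb_phase x a
         + l * (momentum x (a + INR n * l) - momentum x a)) + INR n * PI.
Proof.
  intros H HQ Hk Hx Hl. induction n as [|n IH].
  - simpl. rewrite !Rmult_0_l, Rplus_0_r. lra.
  - rewrite S_INR. set (s := a + INR n * l) in *.
    replace (a + (INR n + 1) * l) with (s + l) by (unfold s; ring).
    assert (St : th (s + l) - th s <= k * momentum x (s + l) * (s + l - s) + PI).
    { apply (phase_upper Q th M); auto; [lra| |].
      - apply Rmult_le_pos; [lra|apply sqrt_pos].
      - intros t Ht. rewrite HQ, Rpow_mult_distr.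
        apply Rmult_le_compat_l; [apply pow2_ge_0|].
        apply Rle_trans with (momentum x t ^ 2).
        + unfold momentum. destruct (Rle_dec 0 (exp t ^ 2 - x ^ 2)).
          * rewrite pow2_sqrt; lra.
          * rewrite sqrt_neg_0 by lra. simpl. simpl in n0. lra.
        + apply pow_incr. split; [apply sqrt_pos|]. apply momentum_increasing. lra. }
    destruct (wkb_phase_step x s l Hx Hl) as [B _].
    apply (Rmult_le_compat_l k) in B; [|lra].
    replace (s + l - s) with l in St by ring. lra.
Qed.

Lemma partition_lower (Q th M : R -> R) (k x a l : R) (n : nat) :
  phase Q th M -> (forall s, Q s = k ^ 2 * (exp s ^ 2 - x ^ 2)) -> 0 < k -> 0 <= x -> 0 < l ->
  k * (wkb_phase x (a + INR n * l) - wkb_phase x a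
       - l * (momentum x (a + INR n * l) - momentum x a)) - INR n * PI
  <= th (a + INR n * l) - th a.
Proof.
  intros H HQ Hk Hx Hl. induction n as [|n IH].
  - simpl. rewrite !Rmult_0_l, Rplus_0_r. lra.
  - rewrite S_INR. set (s := a + INR n * l) in *.
    replace (a + (INR n + 1) * l) with (s + l) by (unfold s; ring).
    assert (St : k * momentum x s * (s + l - s) - PI <= th (s + l) - th s).
    { destruct (Rle_dec 0 (exp s ^ 2 - x ^ 2)) as [P|P].
      - apply (phase_lower Q th M); auto; [lra| |].
        + apply Rmult_le_pos; [lra|apply sqrt_pos].
        + intros t Ht. rewrite HQ, Rpow_mult_distr.
          apply Rmult_le_compat_l; [apply pow2_ge_0|].
          unfold momentum. rewrite pow2_sqrt by exact P.
          assert (exp s ^ 2 <= exp t ^ 2); [|lra].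
          apply pow_incr. split; [left; apply exp_pos|]. left. apply exp_increasing, Ht.
      - (* left of the turning point only the monotonicity of the phase is left *)
        unfold momentum. rewrite sqrt_neg_0 by lra.
        assert (th s < th (s + l)) by (apply H; lra). pose proof PI_RGT_0. lra. }
    destruct (wkb_phase_step x s l Hx Hl) as [_ B].
    apply (Rmult_le_compat_l k) in B; [|lra].
    replace (s + l - s) with l in St by ring. lra.
Qed.

Lemma phase_asymptotics (th M : R -> R) (rho k x y : R) (p : nat) :
  1 < rho -> 0 < k -> 0 <= x -> 0 < y -> (1 <= p)%nat ->
  phase (bessel_potential (k * x)) th M ->
  let s := ln (k * y / 2) in
  Rabs (th (s + ln rho) - th s - k * (y * action rho (x / y)))
    <= k * (ln rho / INR p * (rho * y)) + INR p * PI.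
Proof.
  intros Hrho Hk Hx Hy Hp H s.
  assert (Pp : 0 < INR p) by (apply lt_0_INR; lia).
  assert (HL : 0 < ln rho) by (rewrite <- ln_1; apply ln_increasing; lra).
  (* in the variable [t = 2 e^s / k] the potential is [k^2 (t^2 - x^2)] *)
  set (h := ln (k / 2)). set (a := ln y). set (l := ln rho / INR p).
  assert (Hl : 0 < l) by now apply Rdiv_lt_0_compat.
  assert (Es : s = a + h).
  { unfold s, a, h. rewrite <- ln_mult by lra. f_equal. field. }
  assert (Ea : a + INR p * l = a + ln rho) by (unfold l; field; lra).
  pose proof (phase_shift _ _ _ h H) as Hs.
  assert (HQ : forall t, bessel_potential (k * x) (t + h) = k ^ 2 * (exp t ^ 2 - x ^ 2)).
  { intros t. unfold bessel_potential, h. rewrite exp_plus, exp_ln by lra. field. }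
  pose proof (partition_upper _ _ _ k x a l p Hs HQ Hk Hx Hl) as U.
  pose proof (partition_lower _ _ _ k x a l p Hs HQ Hk Hx Hl) as D.
  cbv beta in U, D. rewrite Ea in U, D.
  replace (a + ln rho + h) with (s + ln rho) in U, D by (rewrite Es; ring).
  rewrite <- Es in U, D.
  assert (EW : wkb_phase x (a + ln rho) - wkb_phase x a = y * action rho (x / y)).
  { unfold wkb_phase, a. rewrite exp_plus, !exp_ln by lra. unfold action.
    replace (x / (y * rho)) with (x / y / rho) by (field; lra). ring. }
  rewrite EW in U, D.
  assert (Mb : 0 <= momentum x (a + ln rho) - momentum x a <= rho * y).
  { assert (momentum x a <= momentum x (a + ln rho)) by (apply momentum_increasing; lra).
    assert (0 <= momentum x a) by apply sqrt_pos.
    assert (momentum x (a + ln rho) <= rho * y); [|lra].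
    unfold momentum, a. rewrite exp_plus, !exp_ln by lra.
    assert (0 < rho * y) by (apply Rmult_lt_0_compat; lra).
    rewrite <- (sqrt_pow2 (rho * y)) by lra. rewrite (Rmult_comm y).
    apply sqrt_le_1_alt. pose proof (pow2_ge_0 x). lra. }
  assert (k * (l * (momentum x (a + ln rho) - momentum x a)) <= k * (l * (rho * y))).
  { apply Rmult_le_compat_l; [lra|]. apply Rmult_le_compat_l; lra. }
  apply Rabs_le. fold l. lra.
Qed.

Lemma exists_nat_ge (z : R) : exists n : nat, (1 <= n)%nat /\ z <= INR n.
Proof.
  destruct (nfloor_ex (Rmax z 0) (Rmax_r _ _)) as [n [_ B]].
  exists (S n). split; [lia|]. rewrite S_INR. pose proof (Rmax_l z 0). lra.
Qed.

(** For every fixed number of cells the half-turns lost are negligible against [k];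
    the number of cells is chosen before [k]. *)
Lemma phase_asymptotics_eps (rho x y eps : R) :
  1 < rho -> 0 <= x -> 0 < y -> 0 < eps ->
  exists N : nat, (1 <= N)%nat /\ forall (k : nat) th M, (N <= k)%nat ->
    phase (bessel_potential (INR k * x)) th M ->
    let s := ln (INR k * y / 2) in
    Rabs (th (s + ln rho) - th s - INR k * (y * action rho (x / y))) <= INR k * eps.
Proof.
  intros Hrho Hx Hy He. pose proof PI_RGT_0 as Hpi.
  assert (HL : 0 < ln rho) by (rewrite <- ln_1; apply ln_increasing; lra).
  destruct (exists_nat_ge (ln rho * (rho * y) / (eps / 2))) as [p [Hp Hp']].
  destruct (exists_nat_ge (INR p * PI / (eps / 2))) as [N [HN HN']].
  exists N. split; [exact HN|]. intros k th M Hk H s.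
  assert (Pp : 0 < INR p) by (apply lt_0_INR; lia).
  assert (Pk : 0 < INR k) by (apply lt_0_INR; lia).
  eapply Rle_trans; [apply (phase_asymptotics th M rho (INR k) x y p); assumption|].
  assert (ln rho / INR p * (rho * y) <= eps / 2).
  { apply (Rmult_le_reg_r (INR p / (eps / 2))); [apply Rdiv_lt_0_compat; lra|].
    replace (ln rho / INR p * (rho * y) * (INR p / (eps / 2)))
      with (ln rho * (rho * y) / (eps / 2)) by (field; lra).
    replace (eps / 2 * (INR p / (eps / 2))) with (INR p) by (field; lra). exact Hp'. }
  assert (INR p * PI <= INR k * (eps / 2)).
  { apply le_INR in Hk.
    apply (Rmult_le_reg_r (/ (eps / 2))); [apply Rinv_0_lt_compat; lra|].
    replace (INR k * (eps / 2) * / (eps / 2)) with (INR k) by (field; lra).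
    unfold Rdiv in HN' at 1. lra. }
  apply (Rmult_le_compat_l (INR k)) in H0; lra.
Qed.

(** * The reciprocal Gamma function *)

Definition gauss_term (x : R) (n : nat) : R :=
  prod_f_R0 (fun i => x + INR i) n / (INR (fact n) * Rpower (INR n) x).

Lemma ln_1p_bound (u : R) : Rabs u <= / 2 -> Rabs (ln (1 + u) - u) <= 2 * u ^ 2.
Proof.
  intros Hu. apply Rabs_le_between in Hu.
  assert (Up : forall v, -1 < v -> ln (1 + v) <= v).
  { intros v Hv. rewrite <- (ln_exp v) at 2. apply ln_le; [lra|]. apply exp_ineq1_le. }
  assert (L1 : ln (1 + u) <= u) by (apply Up; lra).
  assert (L2 : - ln (1 + u) <= - (u / (1 + u))).
  { rewrite <- ln_Rinv by lra.
    replace (/ (1 + u)) with (1 + - (u / (1 + u))) by (field; lra). apply Up.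
    apply (Rmult_lt_reg_r (1 + u)); [lra|].
    replace (- (u / (1 + u)) * (1 + u)) with (- u) by (field; lra). lra. }
  assert (L3 : u ^ 2 / (1 + u) <= 2 * u ^ 2).
  { apply (Rmult_le_reg_r (1 + u)); [lra|].
    replace (u ^ 2 / (1 + u) * (1 + u)) with (u ^ 2) by (field; lra).
    pose proof (pow2_ge_0 u).
    assert (0 <= u ^ 2 * (1 + 2 * u)) by (apply Rmult_le_pos; lra). lra. }
  replace (u / (1 + u)) with (u - u ^ 2 / (1 + u)) in L2 by (field; lra).
  pose proof (pow2_ge_0 u). apply Rabs_le. lra.
Qed.

(** The logarithm of the factor [(1 + d / n) ((n - 1) / n)^d], with [n = i + 2], of a
    product for [1 / Gamma (1 + d)].  The factor [1 + d] of [n = 1] is kept apart, so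
    that [Rabs d < 1] gives [Rabs (d / n) <= 1 / 2] in all the others. *)
Definition log_factor (d : R) (i : nat) : R :=
  ln (1 + d / (INR i + 2)) + d * (ln (INR i + 1) - ln (INR i + 2)).

Definition log_factor_slope (i : nat) : R :=
  / (INR i + 2) + (ln (INR i + 1) - ln (INR i + 2)).

Definition telescoping_bound (i : nat) : R := 2 * (/ (INR i + 1) - / (INR i + 2)).

Lemma telescoping_bound_sq (i : nat) : 2 * (/ (INR i + 2)) ^ 2 <= telescoping_bound i.
Proof.
  unfold telescoping_bound. pose proof (pos_INR i).
  apply Rmult_le_compat_l; [lra|].
  replace (/ (INR i + 1) - / (INR i + 2)) with (/ (INR i + 2) * / (INR i + 1)) by (field; lra).
  simpl. rewrite Rmult_1_r.
  apply Rmult_le_compat_l; [left; apply Rinv_0_lt_compat; lra|].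
  apply Rinv_le_contravar; lra.
Qed.

Lemma sum_n_succ (a : nat -> R) (n : nat) : sum_n a (S n) = sum_n a n + a (S n) :> R.
Proof. exact (sum_Sn a n). Qed.

Lemma is_lim_seq_inv_shift (c : R) : is_lim_seq (fun n => / (INR n + c)) 0.
Proof.
  replace (Finite 0) with (Rbar_inv p_infty) by easy.
  apply is_lim_seq_inv; [|easy].
  apply (is_lim_seq_plus _ _ p_infty c); [apply is_lim_seq_INR|apply is_lim_seq_const|easy].
Qed.

Lemma telescoping_bound_series : is_series telescoping_bound 2.
Proof.
  assert (E : forall n, sum_n telescoping_bound n = 2 - 2 * / (INR n + 2) :> R).
  { induction n as [|n IH].
    - rewrite sum_O. unfold telescoping_bound. simpl INR. field.
    - rewrite sum_n_succ, IH. unfold telescoping_bound.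
      rewrite S_INR. pose proof (pos_INR n). field. lra. }
  change (is_lim_seq (sum_n telescoping_bound) 2).
  apply (is_lim_seq_ext (fun n => 2 - 2 * / (INR n + 2))); [intros; now rewrite E|].
  replace (Finite 2) with (Finite (2 - 2 * 0)) by (f_equal; ring).
  apply is_lim_seq_minus'; [apply is_lim_seq_const|].
  apply (is_lim_seq_scal_l (fun n => / (INR n + 2)) 2 0), is_lim_seq_inv_shift.
Qed.

Lemma log_factor_slope_bound (i : nat) : Rabs (log_factor_slope i) <= telescoping_bound i.
Proof.
  pose proof (pos_INR i). unfold log_factor_slope.
  rewrite <- ln_div by lra.
  replace ((INR i + 1) / (INR i + 2)) with (1 + - / (INR i + 2)) by (field; lra).
  replace (/ (INR i + 2) + ln (1 + - / (INR i + 2)))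
    with (ln (1 + - / (INR i + 2)) - - / (INR i + 2)) by ring.
  eapply Rle_trans; [apply ln_1p_bound|].
  - rewrite Rabs_Ropp, Rabs_pos_eq by (left; apply Rinv_0_lt_compat; lra).
    apply Rinv_le_contravar; lra.
  - replace ((- / (INR i + 2)) ^ 2) with ((/ (INR i + 2)) ^ 2) by ring.
    apply telescoping_bound_sq.
Qed.

Lemma log_factor_bound (d : R) (i : nat) : Rabs d < 1 ->
  Rabs (log_factor d i - d * log_factor_slope i) <= d ^ 2 * telescoping_bound i.
Proof.
  intros Hd. pose proof (pos_INR i). unfold log_factor, log_factor_slope.
  match goal with |- Rabs ?z <= _ =>
    replace z with (ln (1 + d / (INR i + 2)) - d / (INR i + 2)) by (unfold Rdiv; ring) end.
  eapply Rle_trans; [apply ln_1p_bound|].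
  - unfold Rdiv. rewrite Rabs_mult, (Rabs_pos_eq (/ _)) by (left; apply Rinv_0_lt_compat; lra).
    rewrite <- (Rmult_1_l (/ 2)). apply Rmult_le_compat; try lra.
    + apply Rabs_pos.
    + left; apply Rinv_0_lt_compat; lra.
    + apply Rinv_le_contravar; lra.
  - replace (2 * (d / (INR i + 2)) ^ 2) with (d ^ 2 * (2 * (/ (INR i + 2)) ^ 2))
      by (field; lra).
    apply Rmult_le_compat_l; [apply pow2_ge_0|apply telescoping_bound_sq].
Qed.

Lemma log_factor_slope_summable : ex_series log_factor_slope.
Proof.
  apply (ex_series_le log_factor_slope telescoping_bound); [apply log_factor_slope_bound|].
  exists 2. apply telescoping_bound_series.
Qed.

Lemma log_factor_remainder_summable (d : R) : Rabs d < 1 ->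
  ex_series (fun i => Rabs (log_factor d i - d * log_factor_slope i)).
Proof.
  intros Hd.
  apply (ex_series_le (fun i => Rabs (log_factor d i - d * log_factor_slope i))
           (fun i => d ^ 2 * telescoping_bound i)).
  - intros i. unfold norm; simpl. unfold abs; simpl. rewrite Rabs_Rabsolu.
    now apply log_factor_bound.
  - apply (ex_series_scal_l (d ^ 2) telescoping_bound). exists 2. apply telescoping_bound_series.
Qed.

Lemma log_factor_summable (d : R) : Rabs d < 1 -> ex_series (log_factor d).
Proof.
  intros Hd.
  apply (ex_series_ext (fun i => (log_factor d i - d * log_factor_slope i)
                                 + d * log_factor_slope i)).
  { intros i. simpl. ring. }
  apply (ex_series_plus (fun i => log_factor d i - d * log_factor_slope i)
           (fun i => d * log_factor_slope i)).
  - apply ex_series_Rabs, log_factor_remainder_summable, Hd.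
  - apply (ex_series_scal_l d log_factor_slope), log_factor_slope_summable.
Qed.

Lemma log_factor_series_bound (d : R) : Rabs d < 1 ->
  Rabs (Series (log_factor d) - d * Series log_factor_slope) <= 2 * d ^ 2.
Proof.
  intros Hd.
  assert (E : Series (log_factor d) - d * Series log_factor_slope
              = Series (fun i => log_factor d i - d * log_factor_slope i)).
  { rewrite <- Series_scal_l. symmetry. apply Series_minus.
    - now apply log_factor_summable.
    - apply (ex_series_scal_l d log_factor_slope), log_factor_slope_summable. }
  rewrite E. eapply Rle_trans; [apply Series_Rabs, log_factor_remainder_summable, Hd|].
  replace (2 * d ^ 2) with (Series (fun i => d ^ 2 * telescoping_bound i)).
  - apply Series_le.
    + intros i. split; [apply Rabs_pos|now apply log_factor_bound].
    + apply (ex_series_scal_l (d ^ 2) telescoping_bound). exists 2. apply telescoping_bound_series.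
  - rewrite Series_scal_l, (is_series_unique _ _ telescoping_bound_series). ring.
Qed.

Lemma gauss_term_product (d : R) (m : nat) : Rabs d < 1 ->
  gauss_term (1 + d) (m + 2) =
    (1 + d) * exp (sum_n (log_factor d) m) * ((INR m + 3 + d) / (INR m + 2)).
Proof.
  intros Hd. apply Rabs_def2 in Hd.
  assert (F : forall n : nat, 0 < 1 + d / (INR n + 2)).
  { intros n. pose proof (pos_INR n). apply (Rmult_lt_reg_r (INR n + 2)); [lra|].
    replace ((1 + d / (INR n + 2)) * (INR n + 2)) with (INR n + 2 + d) by (field; lra). lra. }
  assert (Ef : forall n, exp (log_factor d n)
             = (1 + d / (INR n + 2)) * (exp (d * ln (INR n + 1)) / exp (d * ln (INR n + 2)))).
  { intros n. unfold log_factor. rewrite exp_plus, exp_ln by apply F.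
    rewrite Rmult_minus_distr_l. unfold Rminus. rewrite exp_plus, exp_Ropp. reflexivity. }
  unfold gauss_term, Rpower. induction m as [|m IH].
  - rewrite sum_O, Ef. simpl.
    replace ((1 + d) * ln (1 + 1)) with (ln (1 + 1) + d * ln (1 + 1)) by ring.
    rewrite exp_plus, exp_ln by lra.
    replace (0 + 2) with (1 + 1) by ring. rewrite Rplus_0_l, ln_1, Rmult_0_r, exp_0.
    pose proof (exp_pos (d * ln (1 + 1))). field. lra.
  - pose proof (pos_INR m) as Pm.
    rewrite sum_n_succ, exp_plus, Ef, S_INR.
    replace (S m + 2)%nat with (S (m + 2)) by lia.
    change (prod_f_R0 (fun i => 1 + d + INR i) (S (m + 2)))
      with (prod_f_R0 (fun i => 1 + d + INR i) (m + 2) * (1 + d + INR (S (m + 2)))).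
    rewrite fact_simpl, mult_INR.
    assert (E2 : INR (m + 2) = INR m + 2) by (rewrite plus_INR; simpl; ring).
    assert (E3 : INR (S (m + 2)) = INR m + 3) by (rewrite S_INR, E2; ring).
    rewrite E2 in IH. rewrite E3.
    replace (INR m + 1 + 1) with (INR m + 2) by ring.
    replace (INR m + 1 + 2) with (INR m + 3) by ring.
    replace ((1 + d) * ln (INR m + 3)) with (ln (INR m + 3) + d * ln (INR m + 3)) by ring.
    replace ((1 + d) * ln (INR m + 2)) with (ln (INR m + 2) + d * ln (INR m + 2)) in IH by ring.
    rewrite exp_plus, exp_ln in IH by lra. rewrite exp_plus, exp_ln by lra.
    pose proof (exp_pos (d * ln (INR m + 2))). pose proof (exp_pos (d * ln (INR m + 3))).
    pose proof (INR_fact_neq_0 (m + 2)).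
    set (Pr := prod_f_R0 (fun i => 1 + d + INR i) (m + 2)) in *.
    set (S := exp (sum_n (log_factor d) m)) in *.
    assert (EP : Pr = (1 + d) * S * ((INR m + 3 + d) / (INR m + 2))
                      * (INR (fact (m + 2)) * ((INR m + 2) * exp (d * ln (INR m + 2))))).
    { rewrite <- IH. field. repeat split; lra. }
    rewrite EP. field. repeat split; lra.
Qed.

Lemma is_lim_seq_inv_ratio (a b : R) : is_lim_seq (fun n => (INR n + a) / (INR n + b)) 1.
Proof.
  destruct (nfloor_ex (Rabs b) (Rabs_pos b)) as [N [_ HN]].
  apply (is_lim_seq_ext_loc (fun n => 1 + (a - b) * / (INR n + b))).
  - exists (S N). intros n Hn. apply le_INR in Hn. rewrite S_INR in Hn.
    pose proof (Rle_abs (- b)) as Hb. rewrite Rabs_Ropp in Hb. field. lra.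
  - replace (Finite 1) with (Finite (1 + (a - b) * 0)) by (f_equal; ring).
    apply is_lim_seq_plus'; [apply is_lim_seq_const|].
    apply (is_lim_seq_scal_l (fun n => / (INR n + b)) (a - b) 0), is_lim_seq_inv_shift.
Qed.

Lemma gauss_term_lim_near_1 (d : R) : Rabs d < 1 ->
  is_lim_seq (gauss_term (1 + d)) ((1 + d) * exp (Series (log_factor d))).
Proof.
  intros Hd. apply (is_lim_seq_incr_n _ 2).
  apply (is_lim_seq_ext (fun m => (1 + d) * exp (sum_n (log_factor d) m)
                                  * ((INR m + (3 + d)) / (INR m + 2)))).
  { intros m. rewrite gauss_term_product by exact Hd. unfold Rdiv. f_equal. ring. }
  rewrite <- (Rmult_1_r (_ * exp _)).
  apply is_lim_seq_mult'; [|apply is_lim_seq_inv_ratio].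
  apply (is_lim_seq_scal_l (fun m => exp (sum_n (log_factor d) m)) (1 + d)
           (exp (Series (log_factor d)))).
  apply (is_lim_seq_continuous exp).
  - apply derivable_continuous_pt, derivable_pt_exp.
  - exact (Series_correct _ (log_factor_summable d Hd)).
Qed.

Lemma gauss_term_shift (x : R) (n : nat) : (1 <= n)%nat ->
  x * gauss_term (x + 1) n = gauss_term x n * ((INR n + (x + 1)) / (INR n + 0)).
Proof.
  intros Hn. assert (0 < INR n) by (apply lt_0_INR; lia).
  assert (E : forall m, x * prod_f_R0 (fun i => x + 1 + INR i) m
                        = prod_f_R0 (fun i => x + INR i) m * (INR m + (x + 1))).
  { induction m as [|m IH]; [simpl; ring|].
    change (x * (prod_f_R0 (fun i => x + 1 + INR i) m * (x + 1 + INR (S m)))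
            = prod_f_R0 (fun i => x + INR i) m * (x + INR (S m)) * (INR (S m) + (x + 1))).
    rewrite <- Rmult_assoc, IH, S_INR. ring. }
  unfold gauss_term. rewrite Rpower_plus, Rpower_1 by lra.
  assert (0 < Rpower (INR n) x) by apply exp_pos.
  pose proof (INR_fact_neq_0 n).
  apply (Rmult_eq_reg_r (INR (fact n) * (Rpower (INR n) x * INR n)));
    [|repeat apply Rmult_integral_contrapositive_currified; lra].
  transitivity (x * prod_f_R0 (fun i => x + 1 + INR i) n); [field; repeat split; lra|].
  rewrite E. field. repeat split; lra.
Qed.

Lemma gauss_term_lim_down (x l : R) :
  is_lim_seq (gauss_term (x + 1)) l -> is_lim_seq (gauss_term x) (x * l).
Proof.
  intros H.
  destruct (nfloor_ex (Rabs (x + 1)) (Rabs_pos _)) as [N [_ HN]].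
  apply (is_lim_seq_ext_loc (fun n => x * gauss_term (x + 1) n
                                      * ((INR n + 0) / (INR n + (x + 1))))).
  - exists (S N). intros n Hn. rewrite gauss_term_shift by lia.
    apply le_INR in Hn. rewrite S_INR in Hn. pose proof (pos_INR N).
    pose proof (Rle_abs (- (x + 1))) as Hb. rewrite Rabs_Ropp in Hb. field. lra.
  - rewrite <- (Rmult_1_r (x * l)).
    apply is_lim_seq_mult'; [|apply is_lim_seq_inv_ratio].
    now apply (is_lim_seq_scal_l _ x l).
Qed.

Lemma gauss_term_lim_up (x l : R) : x <> 0 ->
  is_lim_seq (gauss_term x) l -> is_lim_seq (gauss_term (x + 1)) (l / x).
Proof.
  intros Hx H.
  apply (is_lim_seq_ext_loc (fun n => gauss_term x n
                                      * ((INR n + (x + 1)) / (INR n + 0)) * / x)).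
  - exists 1%nat. intros n Hn. rewrite <- gauss_term_shift by exact Hn. field. exact Hx.
  - replace (l / x) with (l * 1 * / x) by (field; exact Hx).
    apply is_lim_seq_mult'; [|apply is_lim_seq_const].
    apply is_lim_seq_mult'; [exact H|apply is_lim_seq_inv_ratio].
Qed.

Lemma gauss_term_converges (x : R) : exists l : R, is_lim_seq (gauss_term x) l.
Proof.
  assert (H : forall n x, - INR n < x < INR n + 2 -> exists l : R, is_lim_seq (gauss_term x) l).
  { induction n as [|n IH]; intros y Hy.
    - simpl in Hy. exists ((1 + (y - 1)) * exp (Series (log_factor (y - 1)))).
      replace y with (1 + (y - 1)) at 1 by ring.
      apply gauss_term_lim_near_1. apply Rabs_def1; lra.
    - rewrite S_INR in Hy. pose proof (pos_INR n).
      destruct (Rlt_le_dec 1 y) as [H1|H1].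
      + destruct (IH (y - 1)) as [l Hl]; [lra|]. exists (l / (y - 1)).
        replace y with (y - 1 + 1) at 1 by ring. apply gauss_term_lim_up; [lra|exact Hl].
      + destruct (Rlt_le_dec 0 y) as [H0|H0]; [apply IH; lra|].
        destruct (IH (y + 1)) as [l Hl]; [lra|]. exists (y * l). now apply gauss_term_lim_down. }
  destruct (nfloor_ex (Rabs x) (Rabs_pos x)) as [n [_ Hn]].
  apply (H (S n)). rewrite S_INR. apply Rabs_def2 in Hn. lra.
Qed.

Lemma rgamma_lim (x l : R) : is_lim_seq (gauss_term x) l -> rgamma x = l.
Proof.
  intros H. unfold rgamma. apply is_lim_seq_unique in H.
  change (fun n : nat => prod_f_R0 (fun i => x + INR i) n / (INR (fact n) * Rpower (INR n) x))
    with (gauss_term x). now rewrite H.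
Qed.

Lemma rgamma_succ (x : R) : rgamma x = x * rgamma (x + 1).
Proof.
  destruct (gauss_term_converges (x + 1)) as [l Hl].
  rewrite (rgamma_lim (x + 1) l Hl). apply rgamma_lim, gauss_term_lim_down, Hl.
Qed.

Lemma rgamma_near_1 (d : R) : Rabs d < 1 -> rgamma (1 + d) = (1 + d) * exp (Series (log_factor d)).
Proof.
  intros H. apply rgamma_lim, gauss_term_lim_near_1, H.
Qed.

Lemma log_factor_series_0 : Series (log_factor 0) = 0.
Proof.
  assert (H0 : Rabs 0 < 1) by (rewrite Rabs_R0; lra).
  pose proof (log_factor_series_bound 0 H0) as H.
  replace (Series (log_factor 0) - 0 * Series log_factor_slope)
    with (Series (log_factor 0)) in H by ring.
  replace (2 * 0 ^ 2) with 0 in H by ring.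
  pose proof (Rabs_pos (Series (log_factor 0))).
  apply Rabs_eq_0. lra.
Qed.

Lemma rgamma_1 : rgamma 1 = 1.
Proof.
  replace 1 with (1 + 0) at 1 by ring.
  rewrite rgamma_near_1 by (rewrite Rabs_R0; lra).
  rewrite log_factor_series_0, exp_0. ring.
Qed.

Lemma rgamma_pos (x : R) : 0 < x -> 0 < rgamma x.
Proof.
  assert (H : forall n x, 0 < x < INR n + 2 -> 0 < rgamma x).
  { induction n as [|n IH]; intros y Hy.
    - simpl in Hy. replace y with (1 + (y - 1)) by ring.
      rewrite rgamma_near_1 by (apply Rabs_def1; lra).
      apply Rmult_lt_0_compat; [lra|apply exp_pos].
    - rewrite S_INR in Hy. pose proof (pos_INR n).
      destruct (Rlt_le_dec 1 y) as [H1|H1]; [|apply IH; lra].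
      pose proof (IH (y - 1) ltac:(lra)) as P.
      rewrite rgamma_succ in P. replace (y - 1 + 1) with y in P by ring.
      apply (Rmult_lt_reg_l (y - 1)); lra. }
  intros Hx. destruct (nfloor_ex x) as [n [_ Hn]]; [lra|]. apply (H n). lra.
Qed.

Lemma rgamma_neq_0 (x : R) : (forall k : nat, x + INR k <> 0) -> rgamma x <> 0.
Proof.
  assert (H : forall n x, (forall k : nat, x + INR k <> 0) -> 0 < x + INR n -> rgamma x <> 0).
  { induction n as [|n IH]; intros y Hy P.
    - simpl in P. apply Rgt_not_eq, rgamma_pos. lra.
    - rewrite rgamma_succ. apply Rmult_integral_contrapositive_currified.
      + specialize (Hy 0%nat). simpl in Hy. lra.
      + rewrite S_INR in P. apply IH; [|lra].
        intros k. specialize (Hy (S k)). rewrite S_INR in Hy. lra. }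
  intros Hx. destruct (nfloor_ex (Rabs x) (Rabs_pos x)) as [n [_ Hn]].
  apply (H (S n)); [exact Hx|]. rewrite S_INR. apply Rabs_def2 in Hn. lra.
Qed.

Lemma rgamma_opp_nat (n : nat) : rgamma (- INR n) = 0.
Proof.
  induction n as [|n IH].
  - simpl. rewrite rgamma_succ. lra.
  - rewrite rgamma_succ, S_INR. replace (- (INR n + 1) + 1) with (- INR n) by ring.
    rewrite IH. ring.
Qed.

Lemma rgamma_fact (n : nat) : rgamma (INR n + 1) = / INR (fact n).
Proof.
  induction n as [|n IH].
  - simpl. rewrite Rplus_0_l, rgamma_1. field.
  - rewrite fact_simpl, mult_INR, Rinv_mult, <- IH, (rgamma_succ (INR n + 1)), <- (S_INR n).
    field. apply not_0_INR. lia.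
Qed.

(** Differentiability is needed at the integers only, where [Y] is defined by a limit
    in the order.  At [1] it is read off the product of the [log_factor]s, and the functional
    equation carries it to the other integers. *)
Lemma ex_derive_rgamma_1 : ex_derive rgamma 1.
Proof.
  assert (D : is_derive (fun d => Series (log_factor d)) 0 (Series log_factor_slope)).
  { apply is_derive_Reals. intros eps He.
    assert (P : 0 < Rmin (/ 2) (eps / 4)) by (apply Rmin_glb_lt; lra).
    exists (mkposreal _ P). simpl. intros h Hh0 Hh.
    pose proof (Rmin_l (/ 2) (eps / 4)). pose proof (Rmin_r (/ 2) (eps / 4)).
    rewrite Rplus_0_l, log_factor_series_0, Rminus_0_r.
    pose proof (log_factor_series_bound h ltac:(lra)) as B.
    assert (0 < Rabs h) by now apply Rabs_pos_lt.
    apply (Rmult_lt_reg_r (Rabs h)); [easy|].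
    rewrite <- Rabs_mult.
    replace ((Series (log_factor h) / h - Series log_factor_slope) * h)
      with (Series (log_factor h) - h * Series log_factor_slope) by (field; exact Hh0).
    eapply Rle_lt_trans; [exact B|]. rewrite <- (pow2_abs h). simpl. rewrite Rmult_1_r.
    rewrite <- Rmult_assoc. apply Rmult_lt_compat_r; lra. }
  exists (1 * exp (Series (log_factor (1 - 1)))
          + 1 * (Series log_factor_slope * exp (Series (log_factor (1 - 1))))).
  apply (is_derive_ext_loc (fun y => y * exp (Series (log_factor (y - 1))))).
  - assert (E : forall y : R, Rabs (y - 1) < / 2 ->
              y * exp (Series (log_factor (y - 1))) = rgamma y).
    { intros y Hy. replace (rgamma y) with (rgamma (1 + (y - 1))) by (f_equal; ring).
      rewrite rgamma_near_1 by lra. f_equal. ring. }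
    exists (mkposreal (/ 2) ltac:(lra)). exact E.
  - apply (is_derive_mult (fun y => y) (fun y => exp (Series (log_factor (y - 1)))));
      [apply @is_derive_id| |intros; apply Rmult_comm].
    apply (is_derive_comp exp (fun y => Series (log_factor (y - 1)))).
    + apply is_derive_Reals, derivable_pt_lim_exp.
    + replace (Series log_factor_slope) with (scal 1 (Series log_factor_slope))
        by apply Rmult_1_l.
      apply (is_derive_comp (fun d => Series (log_factor d)) (fun y => y - 1)).
      * now rewrite Rminus_diag.
      * auto_derive; [easy|ring].
Qed.

Lemma ex_derive_shift (f : R -> R) (x c : R) :
  ex_derive f (x + c) -> ex_derive (fun y => f (y + c)) x.
Proof.
  intros H. apply (ex_derive_comp f (fun y => y + c)); [exact H|].
  auto_derive. easy.
Qed.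

Lemma ex_derive_rgamma_pos (n : nat) : ex_derive rgamma (INR n + 1).
Proof.
  induction n as [|n IH]; [simpl; rewrite Rplus_0_l; apply ex_derive_rgamma_1|].
  rewrite S_INR. pose proof (pos_INR n).
  apply (ex_derive_ext_loc (fun y => rgamma (y + - (1)) / (y + - (1)))).
  - assert (E : forall y : R, 1 < y -> rgamma (y + - (1)) / (y + - (1)) = rgamma y).
    { intros y Hy. rewrite (rgamma_succ (y + - (1))).
      replace (y + - (1) + 1) with y by ring. field. lra. }
    apply (filter_imp (fun y => 1 < y)); [exact E|apply (open_gt 1); lra].
  - apply ex_derive_div; [|auto_derive; easy|lra].
    apply (ex_derive_shift rgamma). now replace (INR n + 1 + 1 + - (1)) with (INR n + 1) by ring.
Qed.

Lemma is_derive_rgamma_neg (n : nat) : exists l, l <> 0 /\ is_derive rgamma (- INR n) l.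
Proof.
  assert (St : forall x l, is_derive rgamma (x + 1) l -> is_derive rgamma x (rgamma (x + 1) + x * l)).
  { intros x l Hl.
    apply (is_derive_ext (fun y => y * rgamma (y + 1))).
    { intros y. symmetry. apply rgamma_succ. }
    replace (rgamma (x + 1) + x * l) with (1 * rgamma (x + 1) + x * l) by ring.
    apply (is_derive_mult (fun y => y) (fun y => rgamma (y + 1)));
      [apply @is_derive_id| |intros; apply Rmult_comm].
    replace l with (scal 1 l) by apply Rmult_1_l.
    apply (is_derive_comp rgamma (fun y => y + 1)); [exact Hl|auto_derive; [easy|ring]]. }
  induction n as [|n [l [Hl IH]]].
  - destruct ex_derive_rgamma_1 as [l Hl]. exists (rgamma (0 + 1) + 0 * l). split.
    + rewrite Rplus_0_l, rgamma_1. lra.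
    + simpl. rewrite Ropp_0. apply St. now rewrite Rplus_0_l.
  - rewrite S_INR. pose proof (pos_INR n).
    replace (- INR n) with (- (INR n + 1) + 1) in IH by ring.
    eexists. split; [|apply St, IH].
    replace (- (INR n + 1) + 1) with (- INR n) by ring. rewrite rgamma_opp_nat, Rplus_0_l.
    apply Rmult_integral_contrapositive_currified; lra.
Qed.

(** * Entire power series given by two-term recurrences *)

Definition entire (a : nat -> R) : Prop :=
  exists (C : R) (M : nat), forall m, (M <= m)%nat -> Rabs (a m) <= C * (2 ^ m / INR (fact m)).

Lemma exp_terms_summable (C x : R) : ex_series (fun m => C * (x ^ m / INR (fact m))).
Proof.
  apply (ex_series_scal_l C (fun m => x ^ m / INR (fact m))).
  exists (exp x). apply (is_series_ext (fun k => scal (pow_n x k) (/ INR (fact k)))).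
  - intros k. rewrite pow_n_pow. reflexivity.
  - apply is_exp_Reals.
Qed.

Lemma entire_radius (a : nat -> R) : entire a -> CV_radius a = p_infty.
Proof.
  intros [C [M H]].
  assert (In : forall r, 0 <= r -> ex_series (fun n => Rabs (a n * r ^ n))).
  { intros r Hr. apply (ex_series_incr_n _ M).
    apply (ex_series_le (fun k => Rabs (a (M + k)%nat * r ^ (M + k)))
             (fun k => C * ((2 * r) ^ (M + k) / INR (fact (M + k))))).
    - intros k. unfold norm; simpl; unfold abs; simpl. rewrite Rabs_Rabsolu, Rabs_mult.
      rewrite (Rabs_pos_eq (r ^ _)) by now apply pow_le.
      rewrite Rpow_mult_distr.
      replace (C * (2 ^ (M + k) * r ^ (M + k) / INR (fact (M + k))))
        with (C * (2 ^ (M + k) / INR (fact (M + k))) * r ^ (M + k))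
        by (field; apply INR_fact_neq_0).
      apply Rmult_le_compat_r; [now apply pow_le|]. apply H. lia.
    - apply (ex_series_incr_n (fun k => C * ((2 * r) ^ k / INR (fact k))) M), exp_terms_summable. }
  destruct (CV_radius_bounded a) as [Ub _].
  assert (Ge : forall r, 0 <= r -> Rbar_le r (CV_radius a)).
  { intros r Hr. apply Ub.
    destruct (filterlim_bounded (fun n => Rabs (a n * r ^ n))) as [B HB].
    - exists 0. apply (ex_series_lim_0 (fun n => Rabs (a n * r ^ n)) (In r Hr)).
    - exists B. intros n. specialize (HB n). unfold norm in HB; simpl in HB.
      unfold abs in HB; simpl in HB. now rewrite Rabs_Rabsolu in HB. }
  destruct (CV_radius a) as [r| |] eqn:E; [|easy|].
  - pose proof (Ge (Rabs r + 1)) as G. pose proof (Rabs_pos r). pose proof (Rle_abs r).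
    specialize (G ltac:(lra)). simpl in G. lra.
  - now pose proof (Ge 0 (Rle_refl 0)).
Qed.

Lemma entire_inside (a : nat -> R) (x : R) : entire a -> Rbar_lt (Rabs x) (CV_radius a).
Proof. intros H. now rewrite entire_radius. Qed.

Lemma entire_ex (a : nat -> R) (x : R) : entire a -> ex_pseries a x.
Proof. intros H. apply CV_radius_inside, entire_inside, H. Qed.

Lemma entire_is_derive (a : nat -> R) (x : R) :
  entire a -> is_derive (PSeries a) x (PSeries (PS_derive a) x).
Proof. intros H. apply is_derive_PSeries, entire_inside, H. Qed.

Lemma entire_is_derive_2 (a : nat -> R) (x : R) : entire a ->
  is_derive (PSeries (PS_derive a)) x (PSeries (PS_derive (PS_derive a)) x).
Proof.
  intros H. apply is_derive_PSeries. rewrite CV_radius_derive. now apply entire_inside.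
Qed.

(** The factor [2 ^ m] absorbs the inhomogeneous term [(m + 1) c (m + 1)] without
    spoiling the constant. *)
Lemma recurrence_bound (a c : nat -> R) (nu C : R) (M : nat) :
  (forall m, (M <= m)%nat -> 1 <= INR m + 1 + nu) ->
  (forall m, (M <= m)%nat ->
     (INR m + 1) * (INR m + 1 + nu) * a (S m) = - a m - (INR m + 1) * c (S m)) ->
  (forall m, (M <= m)%nat -> (INR m + 1) * Rabs (c (S m)) <= C * (2 ^ m / INR (fact m))) ->
  Rabs (a M) <= C * (2 ^ M / INR (fact M)) ->
  forall m, (M <= m)%nat -> Rabs (a m) <= C * (2 ^ m / INR (fact m)).
Proof.
  intros Hnu Rec Hc H0 m Hm. induction Hm as [|m Hm IH]; [exact H0|].
  specialize (Hnu m Hm). specialize (Rec m Hm). specialize (Hc m Hm).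
  pose proof (pos_INR m). pose proof (INR_fact_lt_0 m).
  apply (Rmult_le_reg_l (INR m + 1)); [lra|].
  rewrite fact_simpl, mult_INR, S_INR.
  replace ((INR m + 1) * (C * (2 ^ S m / ((INR m + 1) * INR (fact m)))))
    with (C * (2 ^ m / INR (fact m)) + C * (2 ^ m / INR (fact m))) by (simpl; field; lra).
  apply Rle_trans with (Rabs (a m) + (INR m + 1) * Rabs (c (S m))); [|lra].
  apply Rle_trans with (Rabs ((INR m + 1) * (INR m + 1 + nu) * a (S m))).
  - rewrite !Rabs_mult, (Rabs_pos_eq (INR m + 1)), (Rabs_pos_eq (INR m + 1 + nu)) by lra.
    rewrite Rmult_assoc. apply Rmult_le_compat_l; [lra|].
    rewrite <- (Rmult_1_l (Rabs _)) at 1. apply Rmult_le_compat_r; [apply Rabs_pos|lra].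
  - rewrite Rec. unfold Rminus. eapply Rle_trans; [apply Rabs_triang|].
    rewrite !Rabs_Ropp, Rabs_mult, (Rabs_pos_eq (INR m + 1)) by lra. lra.
Qed.

(** Frobenius' method in logarithmic form.  The coefficients [r] are those of an
    inhomogeneous term: zero for a Bessel function itself, and [PS_derive] of its
    coefficients once these have been differentiated in the order. *)
Lemma frobenius_series (nu x : R) (a r : nat -> R) : entire a ->
  (forall m, (INR m + 1) * (INR m + 1 + nu) * a (S m) = - a m - r m) ->
  x * PSeries (PS_derive (PS_derive a)) x + (nu + 1) * PSeries (PS_derive a) x + PSeries a x
  = - PSeries r x.
Proof.
  intros He Rec.
  assert (E1 : ex_pseries (PS_derive a) x) by (apply ex_pseries_derive, entire_inside, He).
  assert (E2 : ex_pseries (PS_derive (PS_derive a)) x).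
  { apply ex_pseries_derive. rewrite CV_radius_derive. now apply entire_inside. }
  rewrite <- PSeries_incr_1, <- PSeries_scal, <- PSeries_plus, <- PSeries_plus, <- PSeries_opp.
  - apply PSeries_ext. intros n. unfold PS_plus, PS_scal, PS_opp, PS_incr_1, PS_derive.
    unfold plus, scal, opp; simpl. unfold mult; simpl.
    destruct n as [|n].
    + pose proof (Rec 0%nat) as R0. simpl in R0. unfold zero; simpl. lra.
    + pose proof (Rec (S n)) as R0. rewrite S_INR in R0.
      change (match n with O => 1 | S _ => INR n + 1 end) with (INR (S n)).
      rewrite !S_INR. rewrite ?S_INR in R0. lra.
  - apply ex_pseries_plus; [now apply ex_pseries_incr_1|].
    apply ex_pseries_scal; [apply Rmult_comm|exact E1].
  - now apply entire_ex.
  - now apply ex_pseries_incr_1.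
  - apply ex_pseries_scal; [apply Rmult_comm|exact E1].
Qed.

Definition frobenius (nu : R) (a : nat -> R) (s : R) : R := exp (nu * s) * PSeries a (exp s ^ 2).

Definition frobenius_slope (nu : R) (a : nat -> R) (s : R) : R :=
  exp (nu * s) * (nu * PSeries a (exp s ^ 2) + 2 * exp s ^ 2 * PSeries (PS_derive a) (exp s ^ 2)).

Lemma is_derive_frobenius (nu : R) (a : nat -> R) (s : R) : entire a ->
  is_derive (frobenius nu a) s (frobenius_slope nu a s).
Proof.
  intros H. pose proof (entire_is_derive a (exp s ^ 2) H) as D.
  unfold frobenius, frobenius_slope. simpl in D |- *. auto_derive.
  - repeat split. eexists; exact D.
  - rewrite (is_derive_unique (fun x : R => PSeries a x) _ _ D). ring.
Qed.

Lemma is_derive_frobenius_slope (nu : R) (a r : nat -> R) (s : R) : entire a ->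
  (forall m, (INR m + 1) * (INR m + 1 + nu) * a (S m) = - a m - r m) ->
  is_derive (frobenius_slope nu a) s
    (- bessel_potential nu s * frobenius nu a s
     - 4 * exp s ^ 2 * (exp (nu * s) * PSeries r (exp s ^ 2))).
Proof.
  intros H Rec. pose proof (entire_is_derive a (exp s ^ 2) H) as D.
  pose proof (entire_is_derive_2 a (exp s ^ 2) H) as D2.
  pose proof (frobenius_series nu (exp s ^ 2) a r H Rec) as Fr.
  unfold frobenius, frobenius_slope, bessel_potential.
  replace (PSeries r (exp s ^ 2)) with
    (- (exp s ^ 2 * PSeries (PS_derive (PS_derive a)) (exp s ^ 2)
        + (nu + 1) * PSeries (PS_derive a) (exp s ^ 2) + PSeries a (exp s ^ 2))) by lra.
  clear Fr. simpl in D, D2 |- *. auto_derive.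
  - repeat split; eexists; [exact D|exact D2].
  - rewrite (is_derive_unique (fun x : R => PSeries a x) _ _ D).
    rewrite (is_derive_unique (fun x : R => PSeries (PS_derive a) x) _ _ D2). ring.
Qed.

(** * Bessel functions of the first kind *)

Definition bessel_coef (nu : R) (m : nat) : R :=
  (-1) ^ m / INR (fact m) * rgamma (INR m + nu + 1).

Lemma bessel_J_frobenius (nu s : R) :
  bessel_J nu (2 * exp s) = frobenius nu (bessel_coef nu) s.
Proof.
  unfold bessel_J, frobenius, Rpower.
  replace (2 * exp s / 2) with (exp s) by field. now rewrite ln_exp.
Qed.

Lemma bessel_coef_rec (nu : R) (m : nat) :
  (INR m + 1) * (INR m + 1 + nu) * bessel_coef nu (S m) = - bessel_coef nu m.
Proof.
  unfold bessel_coef. rewrite (rgamma_succ (INR m + nu + 1)), fact_simpl, mult_INR, S_INR.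
  replace (INR m + 1 + nu + 1) with (INR m + nu + 1 + 1) by ring.
  pose proof (pos_INR m). pose proof (INR_fact_neq_0 m). simpl. field. lra.
Qed.

Lemma index_beyond (nu : R) : exists M : nat, forall m, (M <= m)%nat -> Rabs nu + 1 <= INR m.
Proof.
  destruct (exists_nat_ge (Rabs nu + 1)) as [M [_ HM]]. exists M.
  intros m Hm. apply le_INR in Hm. lra.
Qed.

Lemma bessel_coef_entire (nu : R) : entire (bessel_coef nu).
Proof.
  destruct (index_beyond nu) as [M HM].
  exists (Rabs (bessel_coef nu M) / (2 ^ M / INR (fact M))), M.
  assert (P : 0 < 2 ^ M / INR (fact M)).
  { apply Rdiv_lt_0_compat; [apply pow_lt; lra|apply INR_fact_lt_0]. }
  apply (recurrence_bound (bessel_coef nu) (fun _ => 0) nu).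
  - intros m Hm. specialize (HM m Hm). pose proof (Rle_abs (- nu)). rewrite Rabs_Ropp in H. lra.
  - intros m _. rewrite bessel_coef_rec. ring.
  - intros m _. rewrite Rabs_R0, Rmult_0_r. apply Rmult_le_pos.
    + apply Rdiv_le_0_compat; [apply Rabs_pos|exact P].
    + left. apply Rdiv_lt_0_compat; [apply pow_lt; lra|apply INR_fact_lt_0].
  - right. field. split; [apply INR_fact_neq_0|apply pow_nonzero; lra].
Qed.

Lemma bessel_J_solves (nu : R) :
  solves (bessel_potential nu) (frobenius nu (bessel_coef nu)) (frobenius_slope nu (bessel_coef nu)).
Proof.
  pose proof (bessel_coef_entire nu) as H. split; intros s.
  - now apply is_derive_frobenius.
  - replace (- bessel_potential nu s * frobenius nu (bessel_coef nu) s)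
      with (- bessel_potential nu s * frobenius nu (bessel_coef nu) s
            - 4 * exp s ^ 2 * (exp (nu * s) * PSeries (fun _ => 0) (exp s ^ 2))).
    + apply is_derive_frobenius_slope; [exact H|]. intros m. rewrite bessel_coef_rec. ring.
    + rewrite PSeries_const_0. ring.
Qed.

Lemma bessel_coef_opp_low (n m : nat) : (m < n)%nat -> bessel_coef (- INR n) m = 0.
Proof.
  intros H. unfold bessel_coef.
  replace (INR m + - INR n + 1) with (- INR (n - m - 1)).
  - rewrite rgamma_opp_nat. ring.
  - rewrite !minus_INR by lia. simpl. ring.
Qed.

Lemma bessel_coef_opp_high (n j : nat) :
  bessel_coef (- INR n) (n + j) = (-1) ^ n * bessel_coef (INR n) j.
Proof.
  unfold bessel_coef.
  replace (INR (n + j) + - INR n + 1) with (INR j + 1) by (rewrite plus_INR; ring).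
  replace (INR j + INR n + 1) with (INR (n + j) + 1) by (rewrite plus_INR; ring).
  rewrite !rgamma_fact, pow_add. field.
  split; apply INR_fact_neq_0.
Qed.

Lemma exp_INR_mult (n : nat) (s : R) : exp (INR n * s) = exp s ^ n.
Proof.
  rewrite <- Rpower_pow by apply exp_pos. unfold Rpower. now rewrite ln_exp.
Qed.

(** [J_(-n) = (-1)^n J_n]: the first [n] coefficients of [J_(-n)] vanish, as
    [1 / Gamma] does at the poles of [Gamma]. *)
Lemma bessel_J_opp_nat (n : nat) (s : R) :
  frobenius (- INR n) (bessel_coef (- INR n)) s = (-1) ^ n * frobenius (INR n) (bessel_coef (INR n)) s.
Proof.
  unfold frobenius.
  rewrite (PSeries_decr_n_aux (bessel_coef (- INR n)) n) by apply bessel_coef_opp_low.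
  rewrite (PSeries_ext _ (PS_scal ((-1) ^ n) (bessel_coef (INR n)))).
  - rewrite PSeries_scal.
    assert (E : exp (- INR n * s) * (exp s ^ 2) ^ n = exp (INR n * s)).
    { rewrite <- pow_mult, (Nat.mul_comm 2), pow_mult, <- exp_INR_mult.
      replace (exp (INR n * s) ^ 2) with (exp (INR n * s) * exp (INR n * s)) by ring.
      rewrite <- !exp_plus. f_equal. ring. }
    rewrite <- E. ring.
  - intros j. unfold PS_decr_n. rewrite bessel_coef_opp_high. reflexivity.
Qed.

(** * Differentiation in the order *)

Lemma derivable_quotient_lim (f : R -> R) (x l : R) : is_derive f x l <->
  filterlim (fun h => (f (x + h) - f x) / h) (locally' 0) (locally l).
Proof.
  rewrite is_derive_Reals. split.
  - intros H. apply filterlim_locally. intros eps.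
    destruct (H eps (cond_pos eps)) as [d Hd]. exists d. intros h Hh Hh0.
    apply Hd; [exact Hh0|].
    unfold ball in Hh; simpl in Hh. unfold AbsRing_ball, abs, minus, plus, opp in Hh; simpl in Hh.
    now rewrite Ropp_0, Rplus_0_r in Hh.
  - intros H eps He.
    destruct (proj1 (filterlim_locally _ _) H (mkposreal eps He)) as [d Hd].
    exists d. intros h Hh0 Hh. apply (Hd h); [|exact Hh0].
    unfold ball; simpl. unfold AbsRing_ball, abs, minus, plus, opp; simpl.
    now rewrite Ropp_0, Rplus_0_r.
Qed.

Lemma filterlim_sum_f_R0 {T : Type} {F : (T -> Prop) -> Prop} {FF : Filter F}
  (a : T -> nat -> R) (l : nat -> R) (n : nat) :
  (forall m, filterlim (fun h => a h m) F (locally (l m))) ->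
  filterlim (fun h => sum_f_R0 (a h) n) F (locally (sum_f_R0 l n)).
Proof.
  intros H. induction n as [|n IH]; simpl; [apply H|].
  apply (filterlim_comp_2 (fun h => sum_f_R0 (a h) n) (fun h => a h (S n)) Rplus IH (H (S n))).
  apply (filterlim_plus (sum_f_R0 l n) (l (S n))).
Qed.

Lemma series_tail_bound (a B : nat -> R) (n : nat) :
  (forall m, (n <= m)%nat -> Rabs (a m) <= B m) -> ex_series B -> (0 < n)%nat ->
  Rabs (Series a - sum_f_R0 a (Nat.pred n)) <= Series (fun k => B (n + k)%nat).
Proof.
  intros H HB Hn.
  assert (HBn : ex_series (fun k => B (n + k)%nat)) by now apply (ex_series_incr_n B n).
  assert (Ha : ex_series (fun k => Rabs (a (n + k)%nat))).
  { apply (ex_series_le (fun k => Rabs (a (n + k)%nat)) (fun k => B (n + k)%nat)); [|exact HBn].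
    intros k. unfold norm; simpl; unfold abs; simpl. rewrite Rabs_Rabsolu. apply H. lia. }
  rewrite (Series_incr_n a n Hn).
  - replace (sum_f_R0 a (Nat.pred n) + Series (fun k => a (n + k)%nat) - sum_f_R0 a (Nat.pred n))
      with (Series (fun k => a (n + k)%nat)) by ring.
    eapply Rle_trans; [apply Series_Rabs, Ha|].
    apply Series_le; [|exact HBn]. intros k. split; [apply Rabs_pos|apply H; lia].
  - apply (ex_series_incr_n a n). now apply ex_series_Rabs.
Qed.

(** Tannery's theorem: dominated convergence for series. *)
Lemma tannery {T : Type} {F : (T -> Prop) -> Prop} {FF : Filter F}
  (a : T -> nat -> R) (l B : nat -> R) (M : nat) :
  (forall m, filterlim (fun h => a h m) F (locally (l m))) ->
  F (fun h => forall m, (M <= m)%nat -> Rabs (a h m) <= B m) ->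
  (forall m, (M <= m)%nat -> Rabs (l m) <= B m) -> ex_series B ->
  filterlim (fun h => Series (a h)) F (locally (Series l)).
Proof.
  intros Hl Ha HlB HB. apply filterlim_locally. intros eps.
  pose proof (cond_pos eps) as He.
  assert (Tl : is_lim_seq (fun n => sum_f_R0 B n) (Series B)).
  { apply (is_lim_seq_ext (sum_n B)); [intros; apply sum_n_Reals|].
    exact (Series_correct B HB). }
  apply is_lim_seq_spec in Tl.
  destruct (Tl (mkposreal (eps / 3) ltac:(lra))) as [N HN]. simpl in HN.
  set (n := S (N + M)).
  assert (Tail : Series (fun k => B (n + k)%nat) < eps / 3).
  { specialize (HN (N + M)%nat ltac:(lia)).
    rewrite (Series_incr_n B n) in HN by (auto; unfold n; lia).
    simpl in HN. apply Rabs_def2 in HN. unfold n. simpl. lra. }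
  pose proof (proj1 (filterlim_locally _ _) (filterlim_sum_f_R0 a l (Nat.pred n) Hl)
                (mkposreal (eps / 3) ltac:(lra))) as Hs.
  generalize (filter_and _ _ Ha Hs). apply filter_imp. intros h [H1 H2].
  unfold ball in H2 |- *; simpl in H2 |- *.
  unfold AbsRing_ball, abs, minus, plus, opp in H2 |- *; simpl in H2 |- *.
  assert (B1 : Rabs (Series (a h) - sum_f_R0 (a h) (Nat.pred n)) < eps / 3).
  { eapply Rle_lt_trans; [|exact Tail]. apply series_tail_bound; [|exact HB|unfold n; lia].
    intros m Hm. apply H1. unfold n in Hm. lia. }
  assert (B2 : Rabs (Series l - sum_f_R0 l (Nat.pred n)) < eps / 3).
  { eapply Rle_lt_trans; [|exact Tail]. apply series_tail_bound; [|exact HB|unfold n; lia].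
    intros m Hm. apply HlB. unfold n in Hm. lia. }
  apply Rabs_def2 in B1. apply Rabs_def2 in B2. simpl in B1, B2.
  apply Rabs_def2 in H2. apply Rabs_def1; lra.
Qed.

(** The order [nu] is regular when [1 / Gamma] is differentiable at all the points
    where the coefficients of [J_nu] evaluate it. *)
Definition regular_order (nu : R) : Prop := forall m : nat, ex_derive rgamma (INR m + nu + 1).

Definition coef_slope (nu : R) (m : nat) : R := Derive (fun mu => bessel_coef mu m) nu.

Lemma is_derive_coef (nu : R) (m : nat) : regular_order nu ->
  is_derive (fun mu => bessel_coef mu m) nu (coef_slope nu m).
Proof.
  intros H. apply Derive_correct. unfold bessel_coef.
  apply ex_derive_scal. apply (ex_derive_comp rgamma (fun mu => INR m + mu + 1)).
  - apply H.
  - auto_derive. easy.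
Qed.

Lemma coef_slope_rec (nu : R) (m : nat) : regular_order nu ->
  (INR m + 1) * (INR m + 1 + nu) * coef_slope nu (S m)
  = - coef_slope nu m - PS_derive (bessel_coef nu) m.
Proof.
  intros H. pose proof (is_derive_coef nu (S m) H) as D1.
  assert (D2 : is_derive (fun mu => bessel_coef mu m) nu
            (- (INR m + 1) * (1 * bessel_coef nu (S m) + (INR m + 1 + nu) * coef_slope nu (S m)))).
  { apply (is_derive_ext (fun mu => - (INR m + 1) * ((INR m + 1 + mu) * bessel_coef mu (S m)))).
    { intros mu. pose proof (bessel_coef_rec mu m) as E. simpl in E |- *. lra. }
    apply is_derive_scal.
    apply (is_derive_mult (fun mu => INR m + 1 + mu) (fun mu => bessel_coef mu (S m)));
      [auto_derive; [easy|ring]|exact D1|intros; apply Rmult_comm]. }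
  assert (E : coef_slope nu m
            = - (INR m + 1) * (1 * bessel_coef nu (S m) + (INR m + 1 + nu) * coef_slope nu (S m)))
    by exact (is_derive_unique _ _ _ D2).
  rewrite E. unfold PS_derive. rewrite S_INR. ring.
Qed.

Definition coef_quotient (nu h : R) (m : nat) : R := (bessel_coef (nu + h) m - bessel_coef nu m) / h.

Lemma coef_quotient_rec (nu h : R) (m : nat) : h <> 0 ->
  (INR m + 1) * (INR m + 1 + (nu + h)) * coef_quotient nu h (S m)
  = - coef_quotient nu h m - (INR m + 1) * bessel_coef nu (S m).
Proof.
  intros Hh. pose proof (bessel_coef_rec nu m) as E1.
  pose proof (bessel_coef_rec (nu + h) m) as E2. unfold coef_quotient.
  apply (Rmult_eq_reg_r h); [|exact Hh].
  transitivity ((INR m + 1) * (INR m + 1 + (nu + h)) * bessel_coef (nu + h) (S m)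
                - (INR m + 1) * (INR m + 1 + nu) * bessel_coef nu (S m)
                - (INR m + 1) * h * bessel_coef nu (S m)); [field; exact Hh|].
  rewrite E1, E2. field. exact Hh.
Qed.

(** The difference quotients of the coefficients satisfy, uniformly in the increment
    [h], the recurrence that bounds them by the terms of an exponential series. *)
Lemma coef_quotient_bound (nu : R) : regular_order nu ->
  exists (C : R) (M : nat),
    locally' 0 (fun h => forall m, (M <= m)%nat ->
                  Rabs (coef_quotient nu h m) <= C * (2 ^ m / INR (fact m))) /\
    (forall m, (M <= m)%nat -> Rabs (coef_slope nu m) <= C * (2 ^ m / INR (fact m))).
Proof.
  intros H. destruct (bessel_coef_entire nu) as [C0 [M0 HC0]].
  destruct (index_beyond nu) as [M1 HM1].
  set (M := (M0 + M1)%nat).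
  assert (P : forall m, 0 < 2 ^ m / INR (fact m)).
  { intros m. apply Rdiv_lt_0_compat; [apply pow_lt; lra|apply INR_fact_lt_0]. }
  set (A := Rabs (coef_slope nu M) + 1).
  set (C := Rmax (2 * C0) (A / (2 ^ M / INR (fact M)))).
  assert (HA : A <= C * (2 ^ M / INR (fact M))).
  { apply (Rmult_le_reg_r (/ (2 ^ M / INR (fact M)))); [apply Rinv_0_lt_compat, P|].
    rewrite Rmult_assoc, Rinv_r, Rmult_1_r by (apply Rgt_not_eq, P). apply Rmax_r. }
  assert (Hnu : forall h, Rabs h <= 1 -> forall m, (M <= m)%nat -> 1 <= INR m + 1 + (nu + h)).
  { intros h Hh m Hm. specialize (HM1 m ltac:(unfold M in Hm; lia)).
    pose proof (Rle_abs (- nu)) as L1. rewrite Rabs_Ropp in L1.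
    pose proof (Rle_abs (- h)) as L2. rewrite Rabs_Ropp in L2. lra. }
  assert (Hc : forall m, (M <= m)%nat ->
            (INR m + 1) * Rabs (bessel_coef nu (S m)) <= C * (2 ^ m / INR (fact m))).
  { intros m Hm. specialize (HC0 (S m) ltac:(unfold M in Hm; lia)). pose proof (pos_INR m).
    apply Rle_trans with (2 * C0 * (2 ^ m / INR (fact m))).
    - apply (Rmult_le_compat_l (INR m + 1)) in HC0; [|lra].
      rewrite fact_simpl, mult_INR, S_INR in HC0. pose proof (INR_fact_neq_0 m).
      replace (2 * C0 * (2 ^ m / INR (fact m)))
        with ((INR m + 1) * (C0 * (2 ^ S m / ((INR m + 1) * INR (fact m)))))
        by (simpl; field; lra).
      exact HC0.
    - apply Rmult_le_compat_r; [left; apply P|apply Rmax_l]. }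
  exists C, M. split.
  - pose proof (proj1 (derivable_quotient_lim _ _ _) (is_derive_coef nu M H)) as L.
    destruct (proj1 (filterlim_locally _ _) L (mkposreal 1 Rlt_0_1)) as [d Hd].
    assert (Pd : 0 < Rmin d 1) by (apply Rmin_glb_lt; [apply cond_pos|lra]).
    exists (mkposreal _ Pd). intros h Hh Hh0.
    assert (Hb : Rabs h < Rmin d 1).
    { unfold ball in Hh; simpl in Hh. unfold AbsRing_ball, abs, minus, plus, opp in Hh; simpl in Hh.
      now rewrite Ropp_0, Rplus_0_r in Hh. }
    assert (Bd : ball 0 d h).
    { unfold ball; simpl. unfold AbsRing_ball, abs, minus, plus, opp; simpl.
      rewrite Ropp_0, Rplus_0_r. pose proof (Rmin_l d 1). lra. }
    specialize (Hd h Bd Hh0). fold (coef_quotient nu h M) in Hd.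
    pose proof (Rmin_r d 1).
    apply (recurrence_bound (coef_quotient nu h) (bessel_coef nu) (nu + h)).
    + apply Hnu. lra.
    + intros m _. now apply coef_quotient_rec.
    + exact Hc.
    + eapply Rle_trans; [|exact HA]. unfold A.
      unfold ball in Hd; simpl in Hd. unfold AbsRing_ball, abs, minus, plus, opp in Hd; simpl in Hd.
      replace (coef_quotient nu h M)
        with ((coef_quotient nu h M + - coef_slope nu M) + coef_slope nu M) by ring.
      eapply Rle_trans; [apply Rabs_triang|]. lra.
  - apply (recurrence_bound (coef_slope nu) (bessel_coef nu) nu).
    + intros m Hm. replace nu with (nu + 0) by ring. apply Hnu; [rewrite Rabs_R0; lra|exact Hm].
    + intros m _. rewrite coef_slope_rec by exact H. unfold PS_derive. now rewrite S_INR.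
    + exact Hc.
    + unfold A in HA. lra.
Qed.

Lemma coef_slope_entire (nu : R) : regular_order nu -> entire (coef_slope nu).
Proof.
  intros H. destruct (coef_quotient_bound nu H) as [C [M [_ B]]]. now exists C, M.
Qed.

Lemma is_derive_series_order (nu x : R) : regular_order nu ->
  is_derive (fun mu => PSeries (bessel_coef mu) x) nu (PSeries (coef_slope nu) x).
Proof.
  intros H. apply derivable_quotient_lim.
  destruct (coef_quotient_bound nu H) as [C [M [B1 B2]]].
  assert (Ps : forall (b : nat -> R) m, Rabs (b m) <= C * (2 ^ m / INR (fact m)) ->
            Rabs (b m * x ^ m) <= C * ((2 * Rabs x) ^ m / INR (fact m))).
  { intros b m Hm. rewrite Rabs_mult, <- RPow_abs, Rpow_mult_distr.
    replace (C * (2 ^ m * Rabs x ^ m / INR (fact m)))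
      with (C * (2 ^ m / INR (fact m)) * Rabs x ^ m) by (field; apply INR_fact_neq_0).
    apply Rmult_le_compat_r; [apply pow_le, Rabs_pos|exact Hm]. }
  apply (filterlim_ext_loc (fun h => Series (fun m => coef_quotient nu h m * x ^ m))).
  - exists (mkposreal 1 Rlt_0_1). intros h _ Hh.
    unfold PSeries. rewrite <- Series_minus.
    + unfold Rdiv. rewrite <- Series_scal_r. apply Series_ext. intros m.
      unfold coef_quotient. field. exact Hh.
    + apply (ex_series_ext (fun k => scal (pow_n x k) (bessel_coef (nu + h) k))).
      * intros k. rewrite pow_n_pow. apply Rmult_comm.
      * apply (entire_ex _ x), bessel_coef_entire.
    + apply (ex_series_ext (fun k => scal (pow_n x k) (bessel_coef nu k))).
      * intros k. rewrite pow_n_pow. apply Rmult_comm.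
      * apply (entire_ex _ x), bessel_coef_entire.
  - unfold PSeries.
    apply (tannery (fun h m => coef_quotient nu h m * x ^ m) (fun m => coef_slope nu m * x ^ m)
             (fun m => C * ((2 * Rabs x) ^ m / INR (fact m))) M).
    + intros m.
      apply (filterlim_comp_2 (G := locally (coef_slope nu m)) (H := locally (x ^ m))
               (fun h => coef_quotient nu h m) (fun _ => x ^ m) Rmult).
      * apply (proj1 (derivable_quotient_lim _ _ _) (is_derive_coef nu m H)).
      * apply filterlim_const.
      * apply (filterlim_mult (coef_slope nu m) (x ^ m)).
    + revert B1. apply filter_imp. intros h B1 m Hm. apply Ps, B1, Hm.
    + intros m Hm. apply Ps, B2, Hm.
    + apply exp_terms_summable.
Qed.

(** The derivative of [J_nu] in the order, in the variable [s]. *)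
Definition order_slope (nu s : R) : R :=
  s * frobenius nu (bessel_coef nu) s + frobenius nu (coef_slope nu) s.

Lemma is_derive_bessel_J_order (nu s : R) : regular_order nu ->
  is_derive (fun mu => bessel_J mu (2 * exp s)) nu (order_slope nu s).
Proof.
  intros H.
  apply (is_derive_ext (fun mu => frobenius mu (bessel_coef mu) s)).
  { intros mu. symmetry. apply bessel_J_frobenius. }
  unfold order_slope, frobenius.
  pose proof (is_derive_series_order nu (exp s ^ 2) H) as D.
  replace (s * (exp (nu * s) * PSeries (bessel_coef nu) (exp s ^ 2))
           + exp (nu * s) * PSeries (coef_slope nu) (exp s ^ 2))
    with ((s * exp (nu * s)) * PSeries (bessel_coef nu) (exp s ^ 2)
           + exp (nu * s) * PSeries (coef_slope nu) (exp s ^ 2)) by ring.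
  apply (is_derive_mult (fun mu => exp (mu * s)) (fun mu => PSeries (bessel_coef mu) (exp s ^ 2)));
    [auto_derive; [easy|ring]|exact D|intros; apply Rmult_comm].
Qed.

Definition order_slope_deriv (nu s : R) : R :=
  frobenius nu (bessel_coef nu) s + s * frobenius_slope nu (bessel_coef nu) s
  + frobenius_slope nu (coef_slope nu) s.

(** Differentiating Bessel's equation in the order leaves the extra term
    [2 nu J_nu]. *)
Lemma order_slope_equation (nu : R) : regular_order nu ->
  (forall s, is_derive (order_slope nu) s (order_slope_deriv nu s)) /\
  (forall s, is_derive (order_slope_deriv nu) s
     (- bessel_potential nu s * order_slope nu s + 2 * nu * frobenius nu (bessel_coef nu) s)).
Proof.
  intros H. destruct (bessel_J_solves nu) as [J J'].
  pose proof (coef_slope_entire nu H) as Ed.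
  assert (K : forall s, is_derive (frobenius nu (coef_slope nu)) s (frobenius_slope nu (coef_slope nu) s))
    by (intros; now apply is_derive_frobenius).
  pose proof (fun s => is_derive_frobenius_slope nu (coef_slope nu) (PS_derive (bessel_coef nu)) s Ed
                (fun m => coef_slope_rec nu m H)) as K'.
  split; intros s.
  - unfold order_slope, order_slope_deriv.
    apply (is_derive_plus (fun s => s * frobenius nu (bessel_coef nu) s)); [|apply K].
    replace (frobenius nu (bessel_coef nu) s) with (1 * frobenius nu (bessel_coef nu) s) by ring.
    apply (is_derive_mult (fun s => s) (frobenius nu (bessel_coef nu)));
      [apply @is_derive_id|apply J|intros; apply Rmult_comm].
  - replace (- bessel_potential nu s * order_slope nu s + 2 * nu * frobenius nu (bessel_coef nu) s)
      with (frobenius_slope nu (bessel_coef nu) s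
            + (1 * frobenius_slope nu (bessel_coef nu) s
               + s * (- bessel_potential nu s * frobenius nu (bessel_coef nu) s))
            + (- bessel_potential nu s * frobenius nu (coef_slope nu) s
               - 4 * exp s ^ 2 * (exp (nu * s) * PSeries (PS_derive (bessel_coef nu)) (exp s ^ 2)))).
    + unfold order_slope_deriv.
      apply (is_derive_plus (fun s => frobenius nu (bessel_coef nu) s
                                      + s * frobenius_slope nu (bessel_coef nu) s)); [|apply K'].
      apply (is_derive_plus (frobenius nu (bessel_coef nu))); [apply J|].
      apply (is_derive_mult (fun s => s) (frobenius_slope nu (bessel_coef nu)));
        [apply @is_derive_id|apply J'|intros; apply Rmult_comm].
    + unfold order_slope, frobenius_slope, frobenius. ring.
Qed.

(** * Bessel functions of the second kind *)

Lemma regular_order_nat (n : nat) : regular_order (INR n).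
Proof.
  intros m. rewrite <- plus_INR. apply ex_derive_rgamma_pos.
Qed.

Lemma regular_order_opp_nat (n : nat) : regular_order (- INR n).
Proof.
  intros m. destruct (Compare_dec.le_lt_dec n m) as [H|H].
  - replace (INR m + - INR n + 1) with (INR (m - n) + 1) by (rewrite minus_INR by lia; ring).
    apply ex_derive_rgamma_pos.
  - destruct (is_derive_rgamma_neg (n - m - 1)) as [l [_ Hl]]. exists l.
    replace (INR m + - INR n + 1) with (- INR (n - m - 1)); [exact Hl|].
    rewrite !minus_INR by lia. simpl. ring.
Qed.

Lemma is_lim_derive_quotient (f g : R -> R) (x a b : R) :
  f x = 0 -> g x = 0 -> is_derive f x a -> is_derive g x b -> b <> 0 ->
  is_lim (fun t => f t / g t) x (a / b).
Proof.
  intros Hf Hg Df Dg Hb.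
  apply derivable_quotient_lim in Df. apply derivable_quotient_lim in Dg.
  assert (L : is_lim (fun h => ((f (x + h) - f x) / h) / ((g (x + h) - g x) / h)) 0 (a / b)).
  { apply (is_lim_div _ _ 0 a b); [exact Df|exact Dg| |easy].
    intros E. apply Hb. now injection E. }
  apply (is_lim_ext_loc (fun t => ((f (x + (1 * t + - x)) - f x) / (1 * t + - x))
                                  / ((g (x + (1 * t + - x)) - g x) / (1 * t + - x)))).
  - assert (E : forall t : R, t <> x ->
              ((f (x + (1 * t + - x)) - f x) / (1 * t + - x))
              / ((g (x + (1 * t + - x)) - g x) / (1 * t + - x)) = f t / g t).
    { intros t Ht. rewrite Hf, Hg. replace (x + (1 * t + - x)) with t by ring.
      rewrite !Rminus_0_r. unfold Rdiv. rewrite Rinv_mult, Rinv_inv.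
      generalize (/ g t). intros i. field. lra. }
    exists (mkposreal 1 Rlt_0_1). intros t _ Ht. now apply E.
  - apply (is_lim_comp_lin (fun h => ((f (x + h) - f x) / h) / ((g (x + h) - g x) / h)) 1 (- x) x);
      [|lra].
    simpl. replace (1 * x + - x) with 0 by ring. exact L.
Qed.

Lemma cos_nat_PI (n : nat) : cos (INR n * PI) = (-1) ^ n.
Proof.
  induction n as [|n IH]; [simpl; now rewrite Rmult_0_l, cos_0|].
  rewrite S_INR, Rmult_plus_distr_r, Rmult_1_l, neg_cos, IH. simpl. ring.
Qed.

Lemma sign_sq (n : nat) : (-1) ^ n * (-1) ^ n = 1.
Proof.
  rewrite <- Rpow_mult_distr. replace (-1 * -1) with 1 by ring. apply pow1.
Qed.

(** Numerator and denominator of the quotient both vanish at an integer order, the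
    numerator because of [J_(-n) = (-1)^n J_n]; so its limit is the quotient of the
    derivatives in the order. *)
Lemma bessel_Y_nat (n : nat) (s : R) :
  bessel_Y (INR n) (2 * exp s)
  = (order_slope (INR n) s + (-1) ^ n * order_slope (- INR n) s) / PI.
Proof.
  pose proof PI_RGT_0 as Hpi. pose proof (sign_sq n) as Sg.
  unfold bessel_Y. destruct (Req_EM_T (sin (INR n * PI)) 0) as [_|N];
    [|now pose proof (sin_nat_PI n)].
  set (z := 2 * exp s).
  assert (Df : is_derive (fun mu => bessel_J mu z * cos (mu * PI) - bessel_J (- mu) z) (INR n)
            ((-1) ^ n * order_slope (INR n) s + order_slope (- INR n) s)).
  { pose proof (is_derive_bessel_J_order (INR n) s (regular_order_nat n)) as D1.
    pose proof (is_derive_bessel_J_order (- INR n) s (regular_order_opp_nat n)) as D2.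
    fold z in D1, D2. auto_derive.
    - repeat split; eexists; [exact D1|exact D2].
    - rewrite (is_derive_unique (fun mu : R => bessel_J mu z) _ _ D1).
      rewrite (is_derive_unique (fun mu : R => bessel_J mu z) _ _ D2).
      rewrite sin_nat_PI, cos_nat_PI. ring. }
  assert (Dg : is_derive (fun mu => sin (mu * PI)) (INR n) (PI * (-1) ^ n)).
  { auto_derive; [easy|]. rewrite cos_nat_PI. ring. }
  assert (Nz : (-1) ^ n <> 0) by (apply pow_nonzero; lra).
  rewrite (is_lim_unique (fun mu => bessel_Y_quotient mu z) (INR n)
             (((-1) ^ n * order_slope (INR n) s + order_slope (- INR n) s) / (PI * (-1) ^ n))).
  - simpl. apply (Rmult_eq_reg_r (PI * (-1) ^ n));
      [|apply Rmult_integral_contrapositive_currified; lra].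
    field_simplify; [|lra|lra].
    replace (((-1) ^ n) ^ 2) with 1 by (rewrite <- Sg; ring). ring.
  - unfold bessel_Y_quotient.
    apply (is_lim_derive_quotient (fun mu => bessel_J mu z * cos (mu * PI) - bessel_J (- mu) z)
             (fun mu => sin (mu * PI))); auto.
    + unfold z. rewrite !bessel_J_frobenius, bessel_J_opp_nat, cos_nat_PI. ring.
    + apply sin_nat_PI.
    + apply Rmult_integral_contrapositive_currified; lra.
Qed.

(** A Wronskian that vanishes identically in [s], when written as a function of
    [x = e^(2s)], vanishes also in the limit [s -> -oo], where it can be computed. *)
Lemma wronskian_at_origin (w : R -> R) :
  continuous w 0 -> (forall s, w (exp s ^ 2) = 0) -> w 0 = 0.
Proof.
  intros Hc Hw. destruct (Req_dec (w 0) 0) as [|N]; [easy|exfalso].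
  assert (P : 0 < Rabs (w 0)) by now apply Rabs_pos_lt.
  destruct (proj1 (filterlim_locally _ _) Hc (mkposreal _ P)) as [d Hd].
  pose proof (cond_pos d) as Pd.
  assert (E : exp (ln (d / 2) / 2) ^ 2 = d / 2).
  { rewrite <- exp_INR_mult. replace (INR 2 * (ln (d / 2) / 2)) with (ln (d / 2)) by (simpl; field).
    apply exp_ln. lra. }
  specialize (Hd (exp (ln (d / 2) / 2) ^ 2)). rewrite Hw, E in Hd.
  unfold ball in Hd; simpl in Hd. unfold AbsRing_ball, abs, minus, plus, opp in Hd; simpl in Hd.
  rewrite Ropp_0, Rplus_0_r, Rplus_0_l, Rabs_Ropp in Hd.
  rewrite Rabs_pos_eq in Hd by lra. specialize (Hd ltac:(lra)). lra.
Qed.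

(** The Wronskian of [e^(nu s) A (e^(2s))] and [e^(-nu s) B (e^(2s))] as a function
    of [x = e^(2s)]. *)
Definition frobenius_wronskian (nu : R) (a b : nat -> R) (x : R) : R :=
  PSeries a x * (- nu * PSeries b x + 2 * x * PSeries (PS_derive b) x)
  - (nu * PSeries a x + 2 * x * PSeries (PS_derive a) x) * PSeries b x.

Lemma frobenius_wronskian_exp (nu s : R) (a b : nat -> R) :
  frobenius nu a s * frobenius_slope (- nu) b s - frobenius_slope nu a s * frobenius (- nu) b s
  = frobenius_wronskian nu a b (exp s ^ 2).
Proof.
  unfold frobenius, frobenius_slope, frobenius_wronskian.
  assert (E : exp (nu * s) * exp (- nu * s) = 1).
  { rewrite <- exp_plus. replace (nu * s + - nu * s) with 0 by ring. apply exp_0. }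
  match goal with |- _ = ?r => transitivity (exp (nu * s) * exp (- nu * s) * r) end;
    [ring|rewrite E; ring].
Qed.

Lemma frobenius_wronskian_ex_derive (nu x : R) (a b : nat -> R) : entire a -> entire b ->
  ex_derive (frobenius_wronskian nu a b) x.
Proof.
  intros Ha Hb. unfold frobenius_wronskian. auto_derive.
  repeat split; eexists; first [apply entire_is_derive; assumption | apply entire_is_derive_2; assumption].
Qed.

Lemma frobenius_wronskian_0 (nu : R) (a b : nat -> R) :
  frobenius_wronskian nu a b 0 = - 2 * nu * a 0%nat * b 0%nat.
Proof.
  unfold frobenius_wronskian. rewrite !PSeries_0. ring.
Qed.

Lemma bessel_coef_0 (nu : R) : bessel_coef nu 0 = rgamma (nu + 1).
Proof.
  unfold bessel_coef. simpl. rewrite Rplus_0_l. field.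
Qed.

(** For an order that is not an integer, [J_nu] and [J_(-nu)] are independent, since
    neither leading coefficient is at a zero of [1 / Gamma]. *)
Lemma bessel_pair_not_int (nu : R) : 0 <= nu -> sin (nu * PI) <> 0 -> exists du dv,
  solves (bessel_potential nu) (fun s => bessel_J nu (2 * exp s)) du /\
  solves (bessel_potential nu) (fun s => bessel_Y nu (2 * exp s)) dv /\
  exists s0, bessel_J nu (2 * exp s0) * dv s0 - du s0 * bessel_Y nu (2 * exp s0) <> 0.
Proof.
  intros Hnu Hs.
  destruct (bessel_J_solves nu) as [U U']. destruct (bessel_J_solves (- nu)) as [V V'].
  set (u := frobenius nu (bessel_coef nu)) in *.
  set (du := frobenius_slope nu (bessel_coef nu)) in *.
  set (v := frobenius (- nu) (bessel_coef (- nu))) in *.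
  set (dv := frobenius_slope (- nu) (bessel_coef (- nu))) in *.
  set (C := cos (nu * PI)). set (D := / sin (nu * PI)).
  assert (HD : D <> 0) by now apply Rinv_neq_0_compat.
  assert (EJ : forall s, bessel_J nu (2 * exp s) = u s) by (intros; apply bessel_J_frobenius).
  assert (EY : forall s, bessel_Y nu (2 * exp s) = D * (C * u s - v s)).
  { intros s. unfold bessel_Y. destruct (Req_EM_T (sin (nu * PI)) 0) as [E|_]; [easy|].
    unfold bessel_Y_quotient. rewrite !bessel_J_frobenius. fold (u s) (v s) C.
    unfold Rdiv. fold D. ring. }
  exists du, (fun s => D * (C * du s - dv s)).
  split; [|split].
  - split; intros s.
    + apply (is_derive_ext u); [intros; now rewrite EJ|apply U].
    + rewrite EJ. apply U'.
  - split; intros s.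
    + apply (is_derive_ext (fun s => D * (C * u s - v s))); [intros; now rewrite EY|].
      apply is_derive_scal.
      apply (is_derive_minus (fun s => C * u s) v); [apply is_derive_scal, U|apply V].
    + rewrite EY.
      replace (- bessel_potential nu s * (D * (C * u s - v s)))
        with (D * (C * (- bessel_potential nu s * u s) - (- bessel_potential (- nu) s * v s)))
        by (unfold bessel_potential; ring).
      apply is_derive_scal.
      apply (is_derive_minus (fun s => C * du s) dv); [apply is_derive_scal, U'|apply V'].
  - apply NNPP. intros N.
    assert (W : forall s, frobenius_wronskian nu (bessel_coef nu) (bessel_coef (- nu)) (exp s ^ 2) = 0).
    { intros s. rewrite <- frobenius_wronskian_exp. fold (u s) (du s) (v s) (dv s).
      apply NNPP. intros Ns. apply N. exists s. rewrite EJ, EY.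
      replace (u s * (D * (C * du s - dv s)) - du s * (D * (C * u s - v s)))
        with (- D * (u s * dv s - du s * v s)) by ring.
      apply Rmult_integral_contrapositive_currified; [lra|exact Ns]. }
    apply wronskian_at_origin in W.
    + rewrite frobenius_wronskian_0, !bessel_coef_0 in W.
      assert (nu <> 0) by (intros ->; apply Hs; rewrite Rmult_0_l; apply sin_0).
      assert (rgamma (nu + 1) <> 0) by (apply Rgt_not_eq, rgamma_pos; lra).
      assert (rgamma (- nu + 1) <> 0).
      { apply rgamma_neq_0. intros k E. apply Hs.
        replace nu with (INR (S k)) by (rewrite S_INR; lra). apply sin_nat_PI. }
      revert W. repeat apply Rmult_integral_contrapositive_currified; auto; lra.
    + apply (ex_derive_continuous (V := R_NormedModule)), frobenius_wronskian_ex_derive;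
        apply bessel_coef_entire.
Qed.

(** In the limit [s -> -oo] the Wronskian of [J_n] and [PI Y_n] is [2] for [n = 0], from
    the logarithmic term [2 s J_0] of [PI Y_0]; for [n >= 1] it is a nonzero multiple of
    the slope of [1 / Gamma] at the pole [1 - n] of [Gamma], which is not zero. *)
Lemma bessel_pair_nat (n : nat) : exists du dv,
  solves (bessel_potential (INR n)) (fun s => bessel_J (INR n) (2 * exp s)) du /\
  solves (bessel_potential (INR n)) (fun s => bessel_Y (INR n) (2 * exp s)) dv /\
  exists s0, bessel_J (INR n) (2 * exp s0) * dv s0 - du s0 * bessel_Y (INR n) (2 * exp s0) <> 0.
Proof.
  pose proof PI_RGT_0 as Hpi. pose proof (sign_sq n) as Sg.
  set (nu := INR n). set (sg := (-1) ^ n) in *.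
  assert (Rp : regular_order nu) by apply regular_order_nat.
  assert (Rm : regular_order (- nu)) by apply regular_order_opp_nat.
  destruct (bessel_J_solves nu) as [U U']. destruct (bessel_J_solves (- nu)) as [V _].
  destruct (order_slope_equation nu Rp) as [P P'].
  destruct (order_slope_equation (- nu) Rm) as [M M'].
  assert (EJ : forall s, bessel_J nu (2 * exp s) = frobenius nu (bessel_coef nu) s)
    by (intros; apply bessel_J_frobenius).
  assert (EV : forall s, frobenius (- nu) (bessel_coef (- nu)) s = sg * frobenius nu (bessel_coef nu) s)
    by (intros; apply bessel_J_opp_nat).
  assert (EV' : forall s, frobenius_slope (- nu) (bessel_coef (- nu)) s
                          = sg * frobenius_slope nu (bessel_coef nu) s).
  { intros s. rewrite <- (is_derive_unique _ _ _ (V s)).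
    apply is_derive_unique.
    apply (is_derive_ext (fun s => sg * frobenius nu (bessel_coef nu) s)); [intros; now rewrite EV|].
    apply is_derive_scal, U. }
  assert (EY : forall s, bessel_Y nu (2 * exp s)
                         = / PI * (order_slope nu s + sg * order_slope (- nu) s)).
  { intros s. unfold nu. rewrite bessel_Y_nat. unfold Rdiv. apply Rmult_comm. }
  exists (frobenius_slope nu (bessel_coef nu)).
  exists (fun s => / PI * (order_slope_deriv nu s + sg * order_slope_deriv (- nu) s)).
  split; [|split].
  - split; intros s.
    + apply (is_derive_ext (frobenius nu (bessel_coef nu))); [intros; now rewrite EJ|apply U].
    + rewrite EJ. apply U'.
  - split; intros s.
    + apply (is_derive_ext (fun s => / PI * (order_slope nu s + sg * order_slope (- nu) s)));
        [intros; now rewrite EY|].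
      apply is_derive_scal.
      apply (is_derive_plus (order_slope nu) (fun s => sg * order_slope (- nu) s));
        [apply P|apply is_derive_scal, M].
    + rewrite EY.
      (* the terms [2 nu J_nu] and [- 2 nu (-1)^n J_(-nu)] cancel *)
      replace (- bessel_potential nu s * (/ PI * (order_slope nu s + sg * order_slope (- nu) s)))
        with (/ PI * ((- bessel_potential nu s * order_slope nu s
                       + 2 * nu * frobenius nu (bessel_coef nu) s)
                      + sg * (- bessel_potential (- nu) s * order_slope (- nu) s
                       + 2 * - nu * frobenius (- nu) (bessel_coef (- nu)) s))).
      * apply is_derive_scal.
        apply (is_derive_plus (order_slope_deriv nu) (fun s => sg * order_slope_deriv (- nu) s));
          [apply P'|apply is_derive_scal, M'].
      * rewrite EV. unfold bessel_potential. field_simplify; [|lra|lra].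
        replace (sg ^ 2) with 1 by (rewrite <- Sg; ring). field. lra.
  - apply NNPP. intros N.
    set (a := bessel_coef nu). set (d := coef_slope nu). set (e := coef_slope (- nu)).
    set (w := fun x => 2 * (x ^ n * PSeries a x ^ 2)
                + x ^ n * (2 * x * (PSeries a x * PSeries (PS_derive d) x
                                    - PSeries (PS_derive a) x * PSeries d x))
                + sg * frobenius_wronskian nu a e x).
    assert (Ha : entire a) by apply bessel_coef_entire.
    assert (Hd : entire d) by apply coef_slope_entire, Rp.
    assert (He : entire e) by apply coef_slope_entire, Rm.
    assert (W : forall s, w (exp s ^ 2) = 0).
    { intros s. apply NNPP. intros Ns. apply N. exists s. rewrite EJ, EY.
      unfold order_slope, order_slope_deriv. rewrite EV, EV'.
      fold a d e. fold e in Ns.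
      match goal with |- ?l <> 0 => replace l with (/ PI * w (exp s ^ 2)) end.
      - apply Rmult_integral_contrapositive_currified; [apply Rinv_neq_0_compat; lra|exact Ns].
      - unfold w. rewrite <- frobenius_wronskian_exp.
        replace ((exp s ^ 2) ^ n) with (exp (nu * s) * exp (nu * s)).
        + unfold frobenius, frobenius_slope. field_simplify; [|lra|lra].
          replace (sg ^ 2) with 1 by (rewrite <- Sg; ring). field. lra.
        + rewrite <- pow_mult, Nat.mul_comm, pow_mult. unfold nu. rewrite exp_INR_mult. ring. }
    apply wronskian_at_origin in W.
    + unfold w in W. rewrite frobenius_wronskian_0, !PSeries_0 in W.
      assert (Ea : a 0%nat <> 0).
      { unfold a. rewrite bessel_coef_0. apply Rgt_not_eq, rgamma_pos.
        pose proof (pos_INR n). unfold nu. lra. }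
      destruct n as [|k].
      * simpl in W. unfold nu in W. simpl in W.
        apply (Rmult_integral_contrapositive_currified (a 0%nat) (a 0%nat)); auto. lra.
      * assert (Ee : e 0%nat <> 0).
        { destruct (is_derive_rgamma_neg k) as [l [Hl Dl]].
          assert (E : e 0%nat = l); [|now rewrite E].
          unfold e, coef_slope. apply is_derive_unique.
          apply (is_derive_ext (fun mu => rgamma (mu + 1))).
          { intros mu. symmetry. apply bessel_coef_0. }
          replace l with (scal 1 l) by apply Rmult_1_l.
          apply (is_derive_comp rgamma (fun mu => mu + 1)).
          - replace (- nu + 1) with (- INR k) by (unfold nu; rewrite S_INR; ring). exact Dl.
          - auto_derive; [easy|ring]. }
        assert (nu <> 0) by (apply not_0_INR; lia).
        assert (sg <> 0) by (apply pow_nonzero; lra).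
        rewrite pow_i in W by lia.
        assert (Z : sg * (- 2 * nu * a 0%nat * e 0%nat) = 0) by lra.
        revert Z Ea Ee H H0. generalize (a 0%nat) (e 0%nat) sg nu. intros.
        revert Z. repeat apply Rmult_integral_contrapositive_currified; auto; lra.
    + apply (ex_derive_continuous (V := R_NormedModule)). unfold w.
      pose proof (frobenius_wronskian_ex_derive nu 0 a e Ha He) as Dw.
      auto_derive. repeat split; try exact Dw;
        eexists; first [apply entire_is_derive; assumption | apply entire_is_derive_2; assumption].
Qed.

Lemma bessel_pair (nu : R) : 0 <= nu -> exists du dv,
  solves (bessel_potential nu) (fun s => bessel_J nu (2 * exp s)) du /\
  solves (bessel_potential nu) (fun s => bessel_Y nu (2 * exp s)) dv /\
  exists s0, bessel_J nu (2 * exp s0) * dv s0 - du s0 * bessel_Y nu (2 * exp s0) <> 0.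
Proof.
  intros Hnu. destruct (Req_dec (sin (nu * PI)) 0) as [E|N];
    [|now apply bessel_pair_not_int].
  pose proof PI_RGT_0 as Hpi.
  destruct Hnu as [Hp|<-]; [|apply (bessel_pair_nat 0)].
  destruct (sin_zero_nat (nu * PI)) as [k [_ Ek]]; [now apply Rmult_lt_0_compat|exact E|].
  apply Rmult_eq_reg_r in Ek; [|lra]. subst nu. apply bessel_pair_nat.
Qed.

(** * The limit *)

Lemma cross_zero_phase (rho nu : R) : 1 < rho -> 0 <= nu ->
  exists th M, phase (bessel_potential nu) th M /\
    forall k, (1 <= k)%nat -> exists s, cross_zero rho nu k = 2 * exp s /\
      th (s + ln rho) - th s = INR k * PI.
Proof.
  intros Hrho Hnu.
  assert (HL : 0 < ln rho) by (rewrite <- ln_1; apply ln_increasing; lra).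
  destruct (bessel_pair nu Hnu) as [du [dv [U [V [s0 W]]]]].
  destruct (phase_of_pair _ _ _ _ _ s0 U V W) as [th [M [H E]]].
  assert (F : forall s, bessel_cross nu rho (2 * exp s) = 0 <-> sin (th (s + ln rho) - th s) = 0).
  { intros s. rewrite <- E. rewrite exp_plus, exp_ln by lra. unfold bessel_cross.
    replace (rho * (2 * exp s)) with (2 * (exp s * rho)) by ring. reflexivity. }
  destruct (phase_enumeration nu (ln rho) th M _ H HL F) as [a [Ha Hs]].
  exists th, M. split; [exact H|]. intros k Hk.
  rewrite (enumeration_unique (bessel_cross nu rho) (cross_zero rho nu) a); auto.
  apply (epsilon_spec (inhabits (fun _ : nat => 0))
           (enumerates_positive_zeros (bessel_cross nu rho))). now exists a.
Qed.

(** If [y] is above (below) the level curve, the phase has gained more (less) than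
    [k] half-turns at [z = k y], so the [k]-th zero lies to the left (right). *)
Lemma cross_zero_limit (rho : R) (alpha : R -> R) : 1 < rho -> ivp_solution rho alpha ->
  forall x, 0 <= x ->
    is_lim_seq (fun k : nat => cross_zero rho (INR k * x) k / INR k) (Finite (alpha x)).
Proof.
  intros Hrho Sol x Hx.
  pose proof (ivp_solution_level rho alpha Hrho Sol x Hx) as Lev.
  assert (Ra : x / rho < alpha x) by apply Sol, Hx.
  assert (Rx : 0 <= x / rho) by (apply Rdiv_le_0_compat; lra).
  apply is_lim_seq_spec. intros [eps He]. simpl.
  set (e := Rmin (eps / 2) ((alpha x - x / rho) / 2)).
  assert (E1 : e <= eps / 2) by apply Rmin_l.
  assert (E2 : e <= (alpha x - x / rho) / 2) by apply Rmin_r.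
  assert (E3 : 0 < e) by (apply Rmin_glb_lt; lra).
  set (y1 := alpha x - e). set (y2 := alpha x + e).
  assert (A1 : y1 * action rho (x / y1) < PI).
  { rewrite <- Lev. apply action_increasing; unfold y1; lra. }
  assert (A2 : PI < y2 * action rho (x / y2)).
  { rewrite <- Lev. apply action_increasing; unfold y2; lra. }
  destruct (phase_asymptotics_eps rho x y1 ((PI - y1 * action rho (x / y1)) / 2))
    as [N1 [P1 B1]]; [lra|lra|unfold y1; lra|lra|].
  destruct (phase_asymptotics_eps rho x y2 ((y2 * action rho (x / y2) - PI) / 2))
    as [N2 [P2 B2]]; [lra|lra|unfold y2; lra|lra|].
  exists (N1 + N2)%nat. intros k Hk.
  assert (Pk : 0 < INR k) by (apply lt_0_INR; lia).
  destruct (cross_zero_phase rho (INR k * x)) as [th [M [H Z]]];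
    [lra|apply Rmult_le_pos; lra|].
  destruct (Z k ltac:(lia)) as [s [Es Eg]].
  specialize (B1 k th M ltac:(lia) H). specialize (B2 k th M ltac:(lia) H).
  set (s1 := ln (INR k * y1 / 2)) in *. set (s2 := ln (INR k * y2 / 2)) in *.
  apply Rabs_le_between in B1. apply Rabs_le_between in B2.
  assert (HL : 0 < ln rho) by (rewrite <- ln_1; apply ln_increasing; lra).
  assert (Lo : s1 < s).
  { apply Rnot_le_lt. intros Hs.
    assert (INR k * PI <= th (s1 + ln rho) - th s1).
    { destruct Hs as [Hs|Hs]; [|rewrite <- Hs; lra]. left.
      apply (window_gain_increasing (bessel_potential (INR k * x)) th M (ln rho) s s1);
        auto; [apply bessel_potential_increasing|lia|lra]. }
    assert (INR k * (y1 * action rho (x / y1)) < INR k * PI) by (apply Rmult_lt_compat_l; lra).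
    lra. }
  assert (Hi : s < s2).
  { apply Rnot_le_lt. intros Hs.
    assert (INR k * PI < INR k * (y2 * action rho (x / y2))) by (apply Rmult_lt_compat_l; lra).
    destruct Hs as [Hs|Hs]; [|rewrite Hs in B2; lra].
    assert (INR k * PI < th (s + ln rho) - th s); [|lra].
    apply (window_gain_increasing (bessel_potential (INR k * x)) th M (ln rho) s2 s);
      auto; [apply bessel_potential_increasing|lia|lra]. }
  apply exp_increasing in Lo. apply exp_increasing in Hi.
  assert (0 < y1) by (unfold y1; lra). assert (0 < y2) by (unfold y2; lra).
  assert (0 < INR k * y1) by now apply Rmult_lt_0_compat.
  assert (0 < INR k * y2) by now apply Rmult_lt_0_compat.
  unfold s1 in Lo. unfold s2 in Hi. rewrite exp_ln in Lo, Hi by lra.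
  rewrite Es. set (q := 2 * exp s / INR k).
  assert (Eq : 2 * exp s = INR k * q) by (unfold q; field; lra).
  assert (y1 < q) by (apply (Rmult_lt_reg_l (INR k)); lra).
  assert (q < y2) by (apply (Rmult_lt_reg_l (INR k)); lra).
  apply Rabs_def1; unfold y1, y2 in *; lra.
Qed.

Theorem theorem1p1 (rho : R) (hrho : 1 < rho) :
  exists alpha : R -> R,
    ivp_solution rho alpha /\
    (forall y : R -> R, ivp_solution rho y ->
       forall x : R, 0 <= x -> y x = alpha x) /\
    (forall x : R, 0 <= x ->
       is_lim_seq (fun k : nat => cross_zero rho (INR k * x) k / INR k)
         (Finite (alpha x))).
Proof.
  destruct (ivp_solution_exists rho hrho) as [alpha Sol].
  exists alpha. repeat split.
  - apply Sol.
  - apply Sol.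
  - apply Sol.
  - intros y Hy. now apply (ivp_solution_unique rho).
  - now apply cross_zero_limit.
Qed.
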